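(* Let $Q$ be an $(n,q)$-cactus with $q\ge 2$. The following are equivalent: (i) $\overrightarrow{rvc}(Q)=n-2$; (ii) $\overrightarrow{trc}(Q)=2n-3$; (iii) $B(Q)$ is the path $P_q$ and $Q[K_Q]$ is the directed path $\overrightarrow{P}_{q-1}$ on $q-1$ vertices.
   Context: A cactus is a strongly connected oriented graph (finite, no loops, no multiple arcs, no pair of opposite arcs) in which every arc belongs to exactly one directed cycle; its blocks (maximal subdigraphs without a cut-vertex) are directed cycles. An $(n,q)$-cactus has $n$ vertices and $q$ blocks. $K_Q$ is the set of cut-vertices of $Q$ and $Q[K_Q]$ the subdigraph induced by it. The block graph $B(Q)$ has the blocks of $Q$ as vertices, two blocks adjacent iff they share a vertex. $P_q$ is the undirected path on $q$ vertices; $\overrightarrow{P}_{q-1}$ is the directed path on $q-1$ vertices. $\overrightarrow{rvc}(D)$ is the minimum number of colours in a vertex-colouring such that every ordered pair $(x,y)$ is joined by a directed path whose internal vertices have distinct colours. $\overrightarrow{trc}(D)$ is the minimum number of colours in a total-colouring (of vertices and arcs) such that every ordered pair is joined by a directed path whose arcs and internal vertices all receive pairwise distinct colours. *)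

(* Defs.v *)
From mathcomp Require Import all_boot.
Set Implicit Arguments.
Unset Strict Implicit.
Unset Printing Implicit Defensive.

(* A finite digraph is a relation [e] on a finite type [T]; [e x y] says that
   there is an arc from x to y.  The encoding has no multiple arcs. *)

Definition oriented (T : finType) (e : rel T) : Prop :=
  irreflexive e /\ forall x y, e x y -> ~~ e y x.

Definition strongly_connected (T : finType) (e : rel T) : Prop :=
  forall x y, connect e x y.

Definition cycle_arcs (T : finType) (s : seq T) : {set T * T} :=
  [set a | (a.1 \in s) && (a.2 == next s a.1)].

(* A directed cycle is identified with its arc set, so that rotations of the
   vertex sequence give the same cycle. *)
Definition dicycle (T : finType) (e : rel T) (C : {set T * T}) : Prop :=
  exists s : seq T, [/\ s != [::], ucycle e s & C = cycle_arcs s].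

Definition cactus (T : finType) (e : rel T) : Prop :=
  [/\ oriented e, strongly_connected e
    & forall x y, e x y ->
        exists! C : {set T * T}, dicycle e C /\ (x, y) \in C].

(* Vertex set and arc set; meaningful when [is_subdigraph e H] holds. *)
Definition subdigraph (T : finType) : finType := ({set T} * {set T * T})%type.

Definition is_subdigraph (T : finType) (e : rel T) (H : subdigraph T) : bool :=
  [forall a in H.2, [&& e a.1 a.2, a.1 \in H.1 & a.2 \in H.1]].

Definition sub_le (T : finType) (H H' : subdigraph T) : bool :=
  (H.1 \subset H'.1) && (H.2 \subset H'.2).

Definition whole (T : finType) (e : rel T) : subdigraph T :=
  ([set: T], [set a | e a.1 a.2]).

Definition del_vertex (T : finType) (H : subdigraph T) (v : T) : subdigraph T :=
  (H.1 :\ v, [set a in H.2 | (a.1 != v) && (a.2 != v)]).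

Definition underlying (T : finType) (H : subdigraph T) : rel T :=
  [rel x y | ((x, y) \in H.2) || ((y, x) \in H.2)].

Definition n_components (T : finType) (H : subdigraph T) : nat :=
  n_comp (underlying H) H.1.

(* Connectivity, cut-vertices and blocks refer to the underlying undirected
   graph. *)
Definition cut_vertex (T : finType) (H : subdigraph T) (v : T) : bool :=
  (v \in H.1) && (n_components H < n_components (del_vertex H v)).

Definition nonseparable (T : finType) (e : rel T) (H : subdigraph T) : bool :=
  [&& is_subdigraph e H, n_components H == 1 & [forall v, ~~ cut_vertex H v]].

Definition block (T : finType) (e : rel T) (H : subdigraph T) : bool :=
  nonseparable e H &&
  [forall H', nonseparable e H' && sub_le H H' ==> (H' == H)].

Definition nq_cactus (T : finType) (e : rel T) (n q : nat) : Prop :=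
  [/\ cactus e, #|T| = n & #|[set H | block e H]| = q].

Definition cut_vertices (T : finType) (e : rel T) : {set T} :=
  [set v | cut_vertex (whole e) v].

Definition induced (T : finType) (e : rel T) (A : {set T}) :
    rel {x : T | x \in A} :=
  fun x y => e (val x) (val y).

Definition block_graph (T : finType) (e : rel T) :
    rel {H : subdigraph T | block e H} :=
  fun B B' => (B != B') && ((val B).1 :&: (val B').1 != set0).

(* The undirected and the directed path on m vertices. *)
Definition upath (m : nat) : rel 'I_m := fun i j => (i.+1 == j) || (j.+1 == i).

Definition dipath (m : nat) : rel 'I_m := fun i j => i.+1 == j.

Arguments induced {T} e A _ _.
Arguments block_graph {T} e _ _.
Arguments upath m _ _ : clear implicits.
Arguments dipath m _ _ : clear implicits.

Definition isomorphic (T1 T2 : finType) (e1 : rel T1) (e2 : rel T2) : Prop :=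
  exists2 f : T1 -> T2, bijective f & forall x y, e2 (f x) (f y) = e1 x y.

(* [x :: p] is the vertex sequence of a directed path from x to y. *)
Definition directed_path (T : finType) (e : rel T) (x y : T) (p : seq T) : Prop :=
  [/\ path e x p, last x p = y & uniq (x :: p)].

Definition internal (T : finType) (x : T) (p : seq T) : seq T :=
  behead (belast x p).

Definition path_arcs (T : finType) (x : T) (p : seq T) : seq (T * T) :=
  pairmap pair x p.

Definition rainbow_vertex_connected (T : finType) (e : rel T) (k : nat) : Prop :=
  exists c : T -> 'I_k, forall x y, exists2 p : seq T,
    directed_path e x y p & uniq [seq c v | v <- internal x p].

(* [ca] also colours pairs that are not arcs; those colours play no role. *)
Definition total_rainbow_connected (T : finType) (e : rel T) (k : nat) : Prop :=
  exists (cv : T -> 'I_k) (ca : T * T -> 'I_k), forall x y, exists2 p : seq T,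
    directed_path e x y p &
    uniq ([seq cv v | v <- internal x p] ++ [seq ca a | a <- path_arcs x p]).

Definition is_minimum (P : nat -> Prop) (k : nat) : Prop :=
  P k /\ forall j, P j -> k <= j.

(* [is_rvc e k] and [is_trc e k] state that the rainbow vertex-connection
   number, resp. the total rainbow connection number, is k. *)
Definition is_rvc (T : finType) (e : rel T) (k : nat) : Prop :=
  is_minimum (rainbow_vertex_connected e) k.

Definition is_trc (T : finType) (e : rel T) (k : nat) : Prop :=
  is_minimum (total_rainbow_connected e) k.

(* Main.v *)
Require Import Defs.
From mathcomp Require Import all_boot zify.

(* Removing the arcs of a cycle C from a cactus leaves strongly connected pieces,
   each of which contains exactly one vertex of C; the vertex of C in the piece
   of z is the C-gate of z.  A path that uses the arc (c, v) of C never comes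
   back to the gate c, so it ends at a vertex whose C-gate is not c.

   If v lies on no cycle but C, a path through (c, v) that has v
   in its interior thus ends in {z | gate C z <> c}, and two such vertices can
   share a colour when the corresponding sets are disjoint; arcs are coloured by
   their heads.  Two leaf cycles give n - 2 vertex colours and n - 1 arc colours.

   Call (x, y) spanning if every cycle C has an arc from the gate
   of y to the gate of x.  A path from x to y then runs through all of every
   cycle, so it is Hamiltonian.  If no pair is spanning, apply this to the pairs
   formed from two leaf cycles: a cycle that obstructs a pair yields either a
   third leaf cycle or a further vertex that can share a colour, and n - 3
   vertex colours suffice.

   Finally a spanning pair (x, y) amounts to a directed walk from y to x using
   exactly one arc of each cycle; its inner vertices are the cut-vertices and its
   arcs list the blocks in order, which is condition (iii). *)

Set Implicit Arguments.
Unset Strict Implicit.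
Unset Printing Implicit Defensive.

(** * Cycles and gates *)

Section Dicycle.
Variables (T : finType) (e : rel T).
Implicit Types (C D : {set T * T}) (u v w x y z : T) (s p : seq T).

Definition cyc_verts C : {set T} := [set a.1 | a in C].

(** A duplicate-free sequence has at most [#|T|] terms, so a search over bounded sequences decides
    [dicycle]. *)
Definition dicycleb C : bool :=
  [exists s : {bseq #|T| of T},
    [&& val s != [::], cycle e s, uniq s & C == cycle_arcs s]].

Lemma dicycleP C : reflect (dicycle e C) (dicycleb C).
Proof.
apply: (iffP existsP) => [[s /and4P[sN0 cs us /eqP ->]]|[s [sN0 /andP[cs us] ->]]].
  by exists s; split => //; apply/andP.
have ss : size s <= #|T| by rewrite -(card_uniqP us) max_card.
by exists (Bseq ss); rewrite /= sN0 cs us eqxx.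
Qed.

Lemma mem_cycle_arcs s u w :
  ((u, w) \in cycle_arcs s) = (u \in s) && (w == next s u).
Proof. by rewrite inE. Qed.

Lemma cycle_arcs_verts s : cyc_verts (cycle_arcs s) =i s.
Proof.
move=> u; apply/imsetP/idP => [[[a b]]|us]; first by rewrite mem_cycle_arcs => /andP[? _] ->.
by exists (u, next s u) => //; rewrite mem_cycle_arcs us eqxx.
Qed.

Lemma cycle_arcs_rot s n : uniq s -> cycle_arcs (rot n s) = cycle_arcs s.
Proof.
by move=> us; apply/setP => -[u w]; rewrite !mem_cycle_arcs mem_rot next_rot.
Qed.

Lemma dicycle_nonempty C : dicycle e C -> exists u, u \in cyc_verts C.
Proof.
by case=> [[|u s]] [] // _ _ ->; exists u; rewrite cycle_arcs_verts mem_head.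
Qed.

Lemma cyc_verts_tail C u w : (u, w) \in C -> u \in cyc_verts C.
Proof. by move=> uwC; apply/imsetP; exists (u, w). Qed.

Section OneCycle.
Variable C : {set T * T}.
Hypothesis dC : dicycle e C.

Lemma dicycle_arc u w : (u, w) \in C -> e u w.
Proof.
case: dC => s [_ /andP[cs _] ->]; rewrite mem_cycle_arcs => /andP[us /eqP ->].
exact: next_cycle.
Qed.

Lemma cyc_verts_head u w : (u, w) \in C -> w \in cyc_verts C.
Proof.
case: dC => s [_ _ ->]; rewrite mem_cycle_arcs cycle_arcs_verts => /andP[us /eqP ->].
by rewrite mem_next.
Qed.

Lemma dicycle_succ u : u \in cyc_verts C -> exists w, (u, w) \in C.
Proof. by case/imsetP=> -[a b] abC /= ->; exists b. Qed.

Lemma dicycle_pred w : w \in cyc_verts C -> exists u, (u, w) \in C.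
Proof.
case: dC => s [_ /andP[_ us] ->]; rewrite cycle_arcs_verts => ws.
by exists (prev s w); rewrite mem_cycle_arcs mem_prev ws next_prev ?eqxx.
Qed.

Lemma dicycle_succ_inj u w w' : (u, w) \in C -> (u, w') \in C -> w = w'.
Proof.
by case: dC => s [_ _ ->]; rewrite !mem_cycle_arcs => /andP[_ /eqP ->] /andP[_ /eqP ->].
Qed.

Lemma dicycle_pred_inj u u' w : (u, w) \in C -> (u', w) \in C -> u = u'.
Proof.
case: dC => s [_ /andP[_ us] ->]; rewrite !mem_cycle_arcs.
by move=> /andP[_ /eqP ->] /andP[_ /eqP /(congr1 (prev s))]; rewrite !prev_next.
Qed.

(** Iterating [next s] from one vertex of the cycle reaches all the others, so a property passed on
    by each arc of [C] spreads over [C]. *)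
Lemma dicycle_ind (P : T -> Prop) :
  (forall u w, (u, w) \in C -> P u -> P w) ->
  forall u w, u \in cyc_verts C -> w \in cyc_verts C -> P u -> P w.
Proof.
case: dC => s [_ /andP[_ us] ->] step u w; rewrite !cycle_arcs_verts => u_s w_s Pu.
have cs := cycle_next us.
have iterP n : iter n (next s) u \in s /\ P (iter n (next s) u).
  elim: n => //= n [ins IH]; rewrite mem_next; split=> //.
  by apply: step IH; rewrite mem_cycle_arcs ins eqxx.
have uw : fconnect (next s) u w by rewrite (fconnect_cycle cs).
by rewrite -(iter_findex uw); case: (iterP (findex (next s) u w)).
Qed.

Lemma dicycle_connect u w : u \in cyc_verts C -> w \in cyc_verts C ->
  connect [rel a b | (a, b) \in C] u w.
Proof.
move=> uC wC; apply: (dicycle_ind (P := connect _ u)) uC wC _ => //.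
by move=> a b abC ua; apply: connect_trans ua (connect1 _).
Qed.

End OneCycle.
End Dicycle.

Section Cactus.
Variables (T : finType) (e : rel T).
Hypothesis cact : cactus e.
Implicit Types (C D : {set T * T}) (u v w x y z : T) (s p : seq T).

Lemma cactus_irr : irreflexive e. Proof. by case: cact => -[]. Qed.

Lemma cactus_asym x y : e x y -> ~~ e y x. Proof. by case: cact => -[_ asym] _ _; apply: asym. Qed.

Lemma cactus_connect x y : connect e x y. Proof. by case: cact. Qed.

Lemma dicycle_uniq C D a : dicycle e C -> dicycle e D -> a \in C -> a \in D -> C = D.
Proof.
case: a => x y dC dD xyC xyD; case: cact => _ _ /(_ x y (dicycle_arc dC xyC)).
by case=> E [_ uE]; rewrite -(uE C) // -(uE D).
Qed.

Lemma arc_dicycle x y : e x y -> exists2 C, dicycle e C & (x, y) \in C.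
Proof. by case: cact => _ _ H /H [C [[dC xyC] _]]; exists C. Qed.

Lemma dicycle_neq C u w : dicycle e C -> (u, w) \in C -> u != w.
Proof.
move=> dC /(dicycle_arc dC); case: eqP => // ->; by rewrite cactus_irr.
Qed.

Lemma dicycle_asym C u w : dicycle e C -> (u, w) \in C -> (w, u) \notin C.
Proof.
move=> dC /(dicycle_arc dC) /cactus_asym; apply: contra; exact: dicycle_arc.
Qed.

(** * Deleting the arcs of one cycle *)

Definition off C : rel T := [rel x y | e x y && ((x, y) \notin C)].

(** Different cycles share no arc, so [D] survives whole when the arcs of [C] are deleted. *)
Lemma connect_off C D u w : dicycle e C -> dicycle e D -> C != D ->
  u \in cyc_verts D -> w \in cyc_verts D -> connect (off C) u w.
Proof.
move=> dC dD CD uD wD; apply: connect_sub (dicycle_connect dD uD wD) => a b /= abD.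
apply: connect1; rewrite /off /= (dicycle_arc dD abD).
by apply: contraNN CD => abC; rewrite (dicycle_uniq dC dD abC abD).
Qed.

(** An arc outside [C] lies on a cycle other than [C], and the rest of that cycle leads back from
    its head to its tail. *)
Lemma off_connect_sym C : dicycle e C -> connect_sym (off C).
Proof.
move=> dC; have sub x y : connect (off C) x y -> connect (off C) y x.
  move=> /connectP[p]; elim: p x => [|z p IH] x /=; first by move=> _ ->.
  move=> /andP[/andP[exz xzC] pz] yl; apply: connect_trans (IH z pz yl) _.
  have [D dD xzD] := arc_dicycle exz.
  apply: (connect_off dC dD); [|exact (cyc_verts_head dD xzD)|exact (cyc_verts_tail xzD)].
 by apply: contraNneq xzC => ->. 
by move=> x y; apply/idP/idP; apply: sub.
Qed.

(* Otherwise an ear of [C] avoiding its arcs, closed up along [C], would be a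
   second cycle through an arc of [C]. *)
Lemma off_connect_eq C u w : dicycle e C ->
  u \in cyc_verts C -> w \in cyc_verts C -> connect (off C) u w -> u = w.
Proof.
move=> dC uC wC /connectP[p0 pth0]; case/shortenP: pth0 => p pth up _ {p0} wE.
apply/eqP/negPn/negP => uw.
have hasp : has (mem (cyc_verts C)) p.
  case: p pth up wE => [|a p] _ _ wE; first by rewrite wE eqxx in uw.
  by apply/hasP; exists w => //; rewrite wE /= mem_last.
(* The path is cut at its first return [w] to [C]; no vertex of [p1] lies on [C]. *)
case: (split_find hasp) pth up => {p hasp wC wE uw} w p1 p2 wC p1C.
rewrite cat_path rcons_path => /andP[/andP[pth1 eaw] _].
rewrite /= mem_cat mem_rcons inE !negb_or => /andP[/andP[/andP[uw up1] _]].
rewrite cat_uniq rcons_uniq => /andP[/andP[_ up1'] _].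
have := dicycle_connect dC wC uC => /connectP[q0 pth0].
case/shortenP: pth0 => q pthq uq _ {q0} uE.
have qC z : z \in w :: q -> z \in cyc_verts C.
  rewrite inE => /predU1P[->//|]; elim: q w {uq uE uw eaw wC} pthq => //= a q IH w.
  case/andP=> waC pq; rewrite inE => /predU1P[->|]; last by exact: (IH a pq).
  exact (cyc_verts_head dC waC).
case: (lastP q) uE pthq uq qC => [/= uE|q' u']; first by rewrite uE eqxx in uw.
rewrite last_rcons => <- {u'} pthq uq qC.
have uniqs : uniq (u :: p1 ++ w :: q').
  have := uq; rewrite -rcons_cons rcons_uniq /= => /andP[nuq /andP[wq' uq']].
  rewrite mem_cat negb_or up1 nuq /= cat_uniq up1' /= wq' uq' !andbT /=.
  apply: contra p1C => /orP[wp1|/hasP[z zq zp]].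
    by apply/hasP; exists w.
  by apply/hasP; exists z => //; apply: qC; rewrite inE mem_rcons inE zq !orbT.
have dD : dicycle e (cycle_arcs (u :: p1 ++ w :: q')).
  exists (u :: p1 ++ w :: q'); split=> //; apply/andP; split=> //.
  rewrite /cycle rcons_cat cat_path /= (sub_path _ pth1); last by move=> a b /andP[].
  move: eaw => /andP[-> _] /=.
  by rewrite (sub_path _ pthq) // => a b /= abC; apply: dicycle_arc abC.
(* Both cycles contain the arc of [C] that leaves [w]. *)
have CD : C = cycle_arcs (u :: p1 ++ w :: q').
  have [b wbC] := dicycle_succ wC.
  apply: (dicycle_uniq (a := (w, b))) => //.
  rewrite -(cycle_arcs_rot (size (u :: p1)) uniqs) -cat_cons rot_size_cat.
  rewrite mem_cycle_arcs mem_head /=.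
  case: q' pthq {uq qC uniqs dD} => [|c q'] /= /andP[wcC _]; rewrite eqxx; apply/eqP.
    exact (dicycle_succ_inj dC wbC wcC).
  exact (dicycle_succ_inj dC wbC wcC).
(* The first arc of the ear lies on the new cycle but not on [C]. *)
have [c [ucC ucD]] : exists c, (u, c) \notin C /\ (u, c) \in cycle_arcs (u :: p1 ++ w :: q').
  case: p1 pth1 eaw {up1' up1 p1C uniqs dD CD} => [|c p1] /=.
    by move=> _ /andP[_ uwC]; exists w; rewrite uwC mem_cycle_arcs mem_head /= eqxx eqxx.
  case/andP=> /andP[_ ucC] _ _; exists c.
  by rewrite ucC mem_cycle_arcs mem_head /= eqxx eqxx.
by rewrite CD ucD in ucC.
Qed.

(** A path from [x] to some vertex of [C] is followed up to its first arc of [C], or to its end if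
    it has none. *)
Lemma ex_off_connect C x : dicycle e C ->
  exists2 u, u \in cyc_verts C & connect (off C) x u.
Proof.
move=> dC; have [w wC] := dicycle_nonempty dC.
have /connectP[p] := cactus_connect x w.
elim: p x => [|y p IH] x /=; first by move=> _ wE; exists x; rewrite -?wE.
case/andP=> exy pth wE; have [u uC yu] := IH _ pth wE.
have [xyC|xyC] := boolP ((x, y) \in C).
  by exists x => //; apply: cyc_verts_tail xyC.
by exists u => //; apply: connect_trans (connect1 _) yu; rewrite /off /= exy.
Qed.

(* The vertex at which [C] is entered from [x], and left towards [x]. *)
Definition gate C x : T := odflt x [pick u in cyc_verts C | connect (off C) x u].

Section Gate.
Variable C : {set T * T}.
Hypothesis dC : dicycle e C.

Lemma gateP x : gate C x \in cyc_verts C /\ connect (off C) x (gate C x).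
Proof.
rewrite /gate; case: pickP => [u /andP[]//|none].
by have [u uC xu] := ex_off_connect x dC; have := none u; rewrite uC xu.
Qed.

Lemma gate_in x : gate C x \in cyc_verts C. Proof. by case: (gateP x). Qed.

Lemma connect_gate x : connect (off C) x (gate C x). Proof. by case: (gateP x). Qed.

Lemma gate_eq x u : u \in cyc_verts C -> connect (off C) x u -> gate C x = u.
Proof.
move=> uC xu; apply: (off_connect_eq dC (gate_in x) uC).
by apply: connect_trans xu; rewrite off_connect_sym ?connect_gate.
Qed.

Lemma gate_id u : u \in cyc_verts C -> gate C u = u.
Proof. by move=> uC; apply: gate_eq. Qed.

Lemma eq_gate x y : connect (off C) x y -> gate C x = gate C y.
Proof. by move=> xy; apply/(gate_eq (gate_in y))/(connect_trans xy)/connect_gate. Qed.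

Lemma gate_arc x y : e x y -> (x, y) \notin C -> gate C x = gate C y.
Proof. by move=> exy xyC; apply/eq_gate/connect1; rewrite /off /= exy. Qed.

Lemma gate_cycle D u w : dicycle e D -> C != D ->
  u \in cyc_verts D -> w \in cyc_verts D -> gate C u = gate C w.
Proof. by move=> dD CD uD wD; apply/eq_gate/(connect_off dC dD CD). Qed.

(** The gate changes only along an arc of [C], and the new gate is then the head of that arc; a path
    that avoids [c] cannot acquire the gate [c]. *)
Lemma gate_stay w p c : path e w p -> c \notin w :: p -> gate C w != c ->
  gate C (last w p) != c.
Proof.
elim: p w => //= v p IH w /andP[ewv pth]; rewrite inE negb_or => /andP[cw cvp] wc.
apply: IH => //; have [wvC|wvC] := boolP ((w, v) \in C); last by rewrite -(gate_arc ewv wvC).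
rewrite (gate_id (cyc_verts_head dC wvC)).
by move: cvp; rewrite inE negb_or eq_sym => /andP[].
Qed.

Lemma gate_stay_rev w p c : path e w p -> c \notin w :: p -> gate C (last w p) != c ->
  gate C w != c.
Proof.
elim: p w => //= v p IH w /andP[ewv pth]; rewrite inE negb_or => /andP[cw cvp] lc.
have [wvC|wvC] := boolP ((w, v) \in C); last by rewrite (gate_arc ewv wvC); apply: IH.
by rewrite (gate_id (cyc_verts_tail wvC)) eq_sym.
Qed.

Lemma gate_after_arc c v p : path e c (v :: p) -> uniq (c :: v :: p) -> (c, v) \in C ->
  gate C (last v p) != c.
Proof.
move=> /andP[_ pth] /andP[cvp _] cvC; apply: gate_stay pth cvp _.
rewrite (gate_id (cyc_verts_head dC cvC)) eq_sym; exact: dicycle_neq cvC.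
Qed.

Lemma gate_before_arc x p c : path e x (rcons p c) -> uniq (x :: rcons p c) ->
  (last x p, c) \in C -> gate C x != c.
Proof.
rewrite rcons_path -rcons_cons rcons_uniq => /andP[pth _] /andP[cxp _] lcC.
apply: gate_stay_rev pth cxp _; rewrite (gate_id (cyc_verts_tail lcC)).
exact: dicycle_neq lcC.
Qed.

(** Only an arc of [C] changes the gate, its tail being the current gate, and [(u, v)] is the only
    arc of [C] leaving [u]. *)
Lemma gate_leave w p u v : path e w p -> gate C w = u -> gate C (last w p) != u ->
  (u, v) \in C -> u \in w :: p /\ v \in p.
Proof.
elim: p w => [|y p IH] w /=; first by move=> _ ->; rewrite eqxx.
case/andP=> ewy pth wu lu uvC; have [wyC|wyC] := boolP ((w, y) \in C).
  have E : w = u by rewrite -(gate_id (cyc_verts_tail wyC)).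
  rewrite E in wyC *; by rewrite (dicycle_succ_inj dC uvC wyC) !mem_head.
have [] := IH y pth _ lu uvC; first by rewrite -(gate_arc ewy).
by move=> uy vp; rewrite !inE vp orbT; move: uy; rewrite inE => ->; rewrite orbT.
Qed.

Lemma path_covers_cycle x p : path e x p -> (gate C (last x p), gate C x) \in C ->
  {subset cyc_verts C <= x :: p}.
Proof.
set t := gate C (last x p); set s := gate C x => pth tsC.
have sp : s \in x :: p.
  have [v svC] := dicycle_succ (gate_in x).
  have [] // := gate_leave pth (erefl s) _ svC.
  by rewrite -/t; apply: dicycle_neq tsC.
(* From a visited [u] other than the final gate [t] the path still has to change its gate, hence
   takes the arc of [C] leaving [u]; the successor of [t] is [s], already visited. *)
have step u v : (u, v) \in C -> u \in x :: p -> v \in x :: p.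
  move=> uvC uxp; have [ut|ut] := eqVneq u t.
    by rewrite ut in uvC; rewrite (dicycle_succ_inj dC uvC tsC).
  case/splitPl: uxp pth @t tsC ut => p1 p2 lu.
  rewrite cat_path last_cat lu => /andP[pth1 pth2] t tsC ut.
  have [] := gate_leave pth2 (gate_id (cyc_verts_tail uvC)) _ uvC.
    by rewrite eq_sym.
  by move=> _ vp2; rewrite inE mem_cat vp2 !orbT.
by move=> u uC; apply: (dicycle_ind dC step (gate_in x)).
Qed.

End Gate.

(** All vertices of [D] have [C]-gate [w], so a walk off [C] from [z] to a different gate uses no
    arc of [D]; from that gate the cycle [C] leads on to [w], again off [D]. *)
Lemma gate_opposite C D w z : dicycle e C -> dicycle e D -> C != D ->
  w \in cyc_verts C -> w \in cyc_verts D -> gate C z != w -> gate D z = w.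
Proof.
move=> dC dD CD wC wD zw.
suff zu : connect (off D) z (gate C z).
  rewrite (eq_gate dD zu) (gate_cycle dD dC _ (gate_in dC z) wC) 1?eq_sym //.
  exact: gate_id.
have := connect_gate dC z => /connectP[p pth ->].
elim: p z zw pth => //= y p IH z zw /andP[/andP[ezy zyC] pth].
have E := gate_arc dC ezy zyC; apply: connect_trans (IH y _ pth); last by rewrite -E.
apply: connect1; rewrite /off /= ezy; apply: contra zw => zyD.
rewrite (gate_cycle dC dD CD (cyc_verts_tail zyD) wD).
by rewrite gate_id.
Qed.

Lemma share_vertex_eq C D u w : dicycle e C -> dicycle e D -> C != D ->
  u \in cyc_verts C -> u \in cyc_verts D ->
  w \in cyc_verts C -> w \in cyc_verts D -> u = w.
Proof.
move=> dC dD CD uC uD wC wD.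
exact: off_connect_eq uC wC (connect_off dC dD CD uD wD).
Qed.

End Cactus.

(** * Sharing colours *)

Section Colouring.
Variables (T : finType) (e : rel T).
Hypothesis cact : cactus e.
Implicit Types (A B C D L : {set T * T}) (u v w x y z : T) (s p : seq T).

(** In a cactus with a cycle these are exactly the cut-vertices, as [cut_vertexE] shows. *)
Definition shared v : bool :=
  [exists C, exists D, [&& dicycleb e C, dicycleb e D, C != D,
     v \in cyc_verts C & v \in cyc_verts D]].

Lemma sharedP v :
  reflect (exists C D, [/\ dicycle e C, dicycle e D, C != D,
             v \in cyc_verts C & v \in cyc_verts D]) (shared v).
Proof.
apply: (iffP existsP) => [[C /existsP[D /and5P[dC dD CD vC vD]]]|].
  by exists C, D; split=> //; apply/dicycleP.
case=> C [D [/dicycleP dC /dicycleP dD CD vC vD]].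
by exists C; apply/existsP; exists D; apply/and5P.
Qed.

Lemma unshared_eq v C D : ~~ shared v -> dicycle e C -> dicycle e D ->
  v \in cyc_verts C -> v \in cyc_verts D -> C = D.
Proof.
move=> nv dC dD vC vD; apply/eqP/negPn; apply: contra nv => CD.
by apply/sharedP; exists C, D.
Qed.

Lemma other_cycle v C : shared v -> exists D, [/\ dicycle e D, D != C & v \in cyc_verts D].
Proof.
case/sharedP=> D [D' [dD dD' DD' vD vD']].
by have [DC|DC] := eqVneq D C; [exists D'; rewrite -DC eq_sym|exists D].
Qed.

Lemma directed_path_exists x y : exists p, directed_path e x y p.
Proof.
have /connectP[p0 pth0 ->] := cactus_connect cact x y.
by case/shortenP: pth0 => p pth up _; exists p.
Qed.

Lemma internal_sub x p v : v \in internal x p -> v \in p /\ v \in belast x p.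
Proof.
rewrite /internal; case: p => //= a p vp; split; first exact: mem_belast.
by rewrite inE vp orbT.
Qed.

Lemma internal_uniq x p : uniq (x :: p) -> uniq (internal x p).
Proof.
rewrite /internal lastI rcons_uniq => /andP[_]; by case: p => //= a p /andP[].
Qed.

(** As [C] is the only cycle through [v], the path enters [v] by the arc [(c, v)], after which it
    cannot return to [c]. *)
Lemma gate_end_avoids x y p C c v : directed_path e x y p -> dicycle e C ->
  (c, v) \in C -> ~~ shared v -> v \in p -> gate e C y != c.
Proof.
case=> pth <- up dC cvC nv vp; case/path.splitP: vp pth up => p1 p2.
rewrite cat_path rcons_path => /andP[/andP[_ elv] pth2].
rewrite -cat_cons -rcons_cons [x :: p1]lastI cat_uniq.
have [D dD lvD] := arc_dicycle cact elv.
have E : C = D.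
  apply: (unshared_eq nv dC dD); [exact (cyc_verts_head dC cvC)|exact (cyc_verts_head dD lvD)].
rewrite -E in lvD; have {lvD}lc := dicycle_pred_inj dC lvD cvC.
rewrite last_cat last_rcons lc in elv * => up. apply: (gate_after_arc cact dC (v := v)) => //.
  by move: pth2; rewrite last_rcons /= elv.
by move: up; rewrite -cat_uniq -!cats1 -!catA cat_uniq => /and3P[].
Qed.

(** Reversed version: the path leaves [v] by the arc [(v, c)] and has not met [c] before. *)
Lemma gate_start_avoids x y p C c v : directed_path e x y p -> dicycle e C ->
  (v, c) \in C -> ~~ shared v -> v \in belast x p -> gate e C x != c.
Proof.
case=> pth _ up dC vcC nv vp.
have : v \in x :: p by apply: mem_belast.
move=> vxp; case/splitPl: vxp pth up vp => p1 [|w p2] lv.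
  by rewrite cats0 => _; rewrite lastI rcons_uniq lv => /andP[/negbTE->].
rewrite cat_path lv /= => /andP[pth1 /andP[evw _]] up _.
have [D dD vwD] := arc_dicycle cact evw.
have E : C = D by apply: (unshared_eq nv dC dD); apply: cyc_verts_tail; eassumption.
rewrite -E in vwD; have {}E := dicycle_succ_inj dC vwD vcC; subst w.
apply: (gate_before_arc cact dC (p := p1)); rewrite ?lv ?rcons_path ?pth1 ?lv //.
by have : uniq (x :: p1 ++ c :: p2) := up; rewrite -cat_rcons -cat_cons cat_uniq => /and3P[].
Qed.

(* The sets {z | gate e C z != c} and {z | gate e D z != d} are disjoint. *)
Definition apart C c D d := forall z, gate e C z != c -> gate e D z = d.

Lemma apart_sym C c D d : apart C c D d -> apart D d C c.
Proof. by move=> H z zd; apply/eqP/negPn; apply: contra zd => /H ->. Qed.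

(** Otherwise the last vertex [y] would lie in both of the disjoint sets; for tails the same holds
    of the first vertex. *)
Lemma apart_no_heads C c v D d w x y p : dicycle e C -> dicycle e D ->
  (c, v) \in C -> (d, w) \in D -> ~~ shared v -> ~~ shared w -> apart C c D d ->
  directed_path e x y p -> v \in p -> w \in p -> False.
Proof.
move=> dC dD cvC dwD nv nw ap dp vp wp.
have /ap E := gate_end_avoids dp dC cvC nv vp.
by have := gate_end_avoids dp dD dwD nw wp; rewrite E eqxx.
Qed.

Lemma apart_no_tails C c v D d w x y p : dicycle e C -> dicycle e D ->
  (v, c) \in C -> (w, d) \in D -> ~~ shared v -> ~~ shared w -> apart C c D d ->
  directed_path e x y p -> v \in belast x p -> w \in belast x p -> False.
Proof.
move=> dC dD cvC dwD nv nw ap dp vp wp.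
have /ap E := gate_start_avoids dp dC cvC nv vp.
by have := gate_start_avoids dp dD dwD nw wp; rewrite E eqxx.
Qed.

(** * Colourings that make every directed path rainbow *)

Definition path_vertex_colouring k := exists c : T -> 'I_k,
  forall x y p, directed_path e x y p -> uniq [seq c v | v <- internal x p].

Definition path_arc_colouring k := exists c : T * T -> 'I_k,
  forall x y p, directed_path e x y p -> uniq [seq c a | a <- path_arcs x p].

Lemma path_vertex_colouring_rvc k :
  path_vertex_colouring k -> rainbow_vertex_connected e k.
Proof.
case=> c cP; exists c => x y; have [p dp] := directed_path_exists x y.
by exists p => //; apply: cP dp.
Qed.

(** Both colourings are rainbow on every path, so any path joining the pair serves both; the two
    palettes are kept disjoint by [lshift] and [rshift]. *)
Lemma path_colouring_trc k l : path_vertex_colouring k -> path_arc_colouring l ->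
  total_rainbow_connected e (k + l).
Proof.
case=> cv cvP [ca caP]; exists (fun v => lshift l (cv v)), (fun a => rshift k (ca a)).
move=> x y; have [p dp] := directed_path_exists x y; exists p => //.
rewrite (map_comp (lshift l) cv) (map_comp (@rshift k l) ca) cat_uniq.
rewrite (map_inj_uniq (@lshift_inj k l)) (map_inj_uniq (@rshift_inj k l)).
rewrite (cvP _ _ _ dp) (caP _ _ _ dp) andbT /=.
apply/hasPn => _ /mapP[i _ ->]; apply/negP => /mapP[j _ /eqP].
by rewrite eq_sym eq_lrshift.
Qed.

(** The values of [g] avoid [U], so the rank of [g x] in the complement of [U] can be the colour of
    [x]. *)
Lemma merge_colours (U : {set T}) (g : T -> T) : 0 < #|T| -> (forall x, g x \notin U) ->
  exists c : T -> 'I_(#|T| - #|U|), forall v w, c v = c w -> g v = g w.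
Proof.
move=> /card_gt0P[x0 _] gU; have gC x : g x \in ~: U by rewrite inE.
have E : #|~: U| = #|T| - #|U| by rewrite -(cardsC U) addKn.
exists (fun x => cast_ord E (enum_rank_in (gC x0) (g x))) => v w /cast_ord_inj.
exact: enum_rank_in_inj.
Qed.

Lemma map_path_arcs_head x p : [seq a.2 | a <- path_arcs x p] = p.
Proof. by rewrite /path_arcs; elim: p x => //= a p IH x; rewrite IH. Qed.

(** Two such vertices may receive the same colour. *)
Definition never_both v w := forall x y p, directed_path e x y p ->
  v \in internal x p -> w \in internal x p -> False.

Lemma never_both_sym v w : never_both v w -> never_both w v.
Proof. by move=> H x y p dp wi vi; apply: (H x y p). Qed.

Lemma merge_vertex_colouring (U : {set T}) (g : T -> T) : 0 < #|T| ->
  (forall x, g x \notin U) -> (forall v w, g v = g w -> v != w -> never_both v w) ->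
  path_vertex_colouring (#|T| - #|U|).
Proof.
move=> T0 gU gnb; have [c cP] := merge_colours T0 gU; exists c => x y p dp.
rewrite map_inj_in_uniq; first by case: dp => _ _ /internal_uniq.
move=> v w vi wi /cP gvw; apply/eqP/negPn/negP => vw.
exact: (gnb v w gvw vw x y p).
Qed.

Lemma merge2_vertex_colouring u1 u2 w1 w2 :
  [&& u1 != u2, w1 != u1, w1 != u2, w2 != u1, w2 != u2 & w1 != w2] ->
  never_both u1 w1 -> never_both u2 w2 -> path_vertex_colouring (#|T| - 2).
Proof.
case/and5P=> u12 w11 w12 w21 /andP[w22 w1w2] n1 n2.
have <- : #|[set u1; u2]| = 2 by rewrite cards2 u12.
pose g x := if x == u1 then w1 else if x == u2 then w2 else x.
apply: (@merge_vertex_colouring _ g).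
- by apply/card_gt0P; exists u1.
- move=> x; rewrite /g !inE negb_or.
  case: (eqVneq x u1) => [_|x1]; first by rewrite w11 w12.
  by case: (eqVneq x u2) => [_|x2]; rewrite ?w21 ?w22 ?x1 ?x2.
have n1' := never_both_sym n1; have n2' := never_both_sym n2.
move=> v w; rewrite /g.
case: (eqVneq v u1) => [->|v1]; [|case: (eqVneq v u2) => [->|v2]];
  (case: (eqVneq w u1) => [->|w1']; [|case: (eqVneq w u2) => [->|w2']]);
  move=> E vw; try (by rewrite E eqxx in vw); try (by subst);
  by move: w1w2; rewrite E eqxx.
Qed.

(** Each [ui] takes the colour of [wi]. The case [w1 = w2] gives a colour class of three vertices,
    for which the last hypothesis is there. *)
Lemma merge3_vertex_colouring u1 u2 u3 w1 w2 w3 :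
  [&& u1 != u2, u1 != u3 & u2 != u3] ->
  [&& w1 != u1, w1 != u2 & w1 != u3] -> [&& w2 != u1, w2 != u2 & w2 != u3] ->
  [&& w3 != u1, w3 != u2 & w3 != u3] -> w1 != w3 -> w2 != w3 ->
  never_both u1 w1 -> never_both u2 w2 -> never_both u3 w3 ->
  (w1 = w2 -> never_both u1 u2) -> path_vertex_colouring (#|T| - 3).
Proof.
case/and3P=> u12 u13 u23 /and3P[w11 w12 w13] /and3P[w21 w22 w23] /and3P[w31 w32 w33].
move=> ww13 ww23 n1 n2 n3 n12.
have <- : #|[set u1; u2; u3]| = 3.
  by rewrite setUC cardsU1 !inE negb_or eq_sym u13 eq_sym u23 cards2 u12.
pose g x := if x == u1 then w1 else if x == u2 then w2 else if x == u3 then w3 else x.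
apply: (@merge_vertex_colouring _ g).
- by apply/card_gt0P; exists u1.
- move=> x; rewrite /g !inE !negb_or.
  case: (eqVneq x u1) => [_|x1]; first by rewrite w11 w12.
  case: (eqVneq x u2) => [_|x2]; first by rewrite w21 w22.
  by case: (eqVneq x u3) => [_|x3]; rewrite ?w31 ?w32 ?w33 ?x1 ?x2 ?x3.
have n1' := never_both_sym n1; have n2' := never_both_sym n2.
have n3' := never_both_sym n3.
move=> v w; rewrite /g.
case: (eqVneq v u1) => [->|v1];
 [|case: (eqVneq v u2) => [->|v2]; [|case: (eqVneq v u3) => [->|v3]]];
 (case: (eqVneq w u1) => [->|w1'];
 [|case: (eqVneq w u2) => [->|w2']; [|case: (eqVneq w u3) => [->|w3']]]);
  move=> E vw; try (by rewrite E eqxx in vw); try (by subst);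
  try (by move: ww13; rewrite E eqxx); try (by move: ww23; rewrite E eqxx);
  by [apply: n12|apply/never_both_sym/n12].
Qed.

End Colouring.

(** * Leaf cycles and spanning pairs *)

Section Bounds.
Variables (T : finType) (e : rel T).
Hypothesis cact : cactus e.
Implicit Types (A B C D L : {set T * T}) (a b c d l u v w x y z : T) (s p : seq T).

(** A leaf of the tree-like arrangement of cycles: [l] is the only vertex at which other cycles can
    be attached. *)
Definition leaf L l := [/\ dicycle e L, l \in cyc_verts L &
  forall w, w \in cyc_verts L -> w != l -> ~~ shared e w].

(** A gate other than [l] lies on no further cycle, so no arc outside [L] leaves it and the walk off
    [L] from it to [z] is trivial. *)
Lemma leaf_gate L l z : leaf L l -> gate e L z != l -> z \in cyc_verts L.
Proof.
case=> dL lL unL zl; have gL := gate_in cact dL z.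
have ng := unL _ gL zl; have := connect_gate cact dL z.
rewrite (off_connect_sym cact dL) => /connectP[[|w p] /=]; first by move=> _ ->.
case/andP=> /andP[egw gwL] _ _; have [D dD gwD] := arc_dicycle cact egw.
have E := unshared_eq ng dL dD gL (cyc_verts_tail gwD).
by rewrite -E in gwD; rewrite gwD in gwL.
Qed.

(** If [C] has a shared vertex [w] other than [c], the search moves to another cycle [D] through
    [w]. By [gate_opposite] the part beyond [w] in [D] lies inside the part beyond [c] in [C], and
    it has lost [w], so the descent ends. *)
Lemma leaf_exists C c : dicycle e C -> c \in cyc_verts C ->
  exists L l, leaf L l /\ forall z, gate e L z != l -> gate e C z != c.
Proof.
have [n] := ubnP #|[set z | gate e C z != c]|; elim: n C c => // n IH C c ltn dC cC.
have [/existsP[w /and3P[wC wc shw]]|none] :=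
  boolP [exists w, [&& w \in cyc_verts C, w != c & shared e w]]; last first.
  exists C, c; split=> //; split=> // w wC wc; apply: contra none => shw.
  by apply/existsP; exists w; apply/and3P.
have [D [dD DC wD]] := other_cycle C shw.
have sub z : gate e D z != w -> gate e C z != c.
  move=> zw; suff -> : gate e C z = w by [].
  by apply: (gate_opposite cact dD dC).
have [|L [l [Ll subL]]] := IH D w _ dD wD; last by exists L, l; split=> // z /subL /sub.
rewrite ltnS in ltn; apply: (leq_trans _ ltn); apply: proper_card; apply/properP; split.
  by apply/subsetP=> z; rewrite !inE; apply: sub.
by exists w; rewrite !inE ?(gate_id cact dC wC) ?(gate_id cact dD wD) ?eqxx.
Qed.

(** Otherwise no walk could leave [C], which would then contain a vertex of [D], and that vertex
    would be shared. *)
Lemma shared_vertex_exists C D : dicycle e C -> dicycle e D -> C != D ->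
  exists2 v, v \in cyc_verts C & shared e v.
Proof.
move=> dC dD CD.
have [/exists_inP[v vC sv]|/exists_inPn none] :=
  boolP [exists v in cyc_verts C, shared e v]; first by exists v.
have [u uC] := dicycle_nonempty dC; have [w wD] := dicycle_nonempty dD.
have wC : w \in cyc_verts C.
  have /connectP[p] := cactus_connect cact u w.
  elim: p u uC => [|z p IH] u uC /=; first by move=> _ ->.
  case/andP=> euz pth wl; apply: (IH z) => //.
  have [E dE uzE] := arc_dicycle cact euz.
  have CE := unshared_eq (none u uC) dC dE uC (cyc_verts_tail uzE).
  rewrite CE; exact (cyc_verts_head dE uzE).
by case/eqP: CD; apply: (unshared_eq (none w wC)).
Qed.

(** Two cycles meet at a shared vertex; descending from it into each of them yields leaves in
    disjoint parts. *)
Lemma two_leaves C D : dicycle e C -> dicycle e D -> C != D ->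
  exists A a B b, [/\ leaf A a, leaf B b & apart e A a B b].
Proof.
move=> dC dD CD; have [v _ /sharedP[C' [D' [dC' dD' CD' vC vD]]]] :=
  shared_vertex_exists dC dD CD.
have [A [a [La subA]]] := leaf_exists dC' vC.
have [B [b [Lb subB]]] := leaf_exists dD' vD.
exists A, a, B, b; split=> // z /subA zC; apply/eqP/negPn/negP => /subB.
by rewrite (gate_opposite cact dC' dD' CD' vC vD zC) eqxx.
Qed.

Lemma leaf_succ L l u : leaf L l -> (l, u) \in L -> ~~ shared e u /\ gate e L u != l.
Proof.
case=> dL lL unL luL; have uL := cyc_verts_head dL luL.
by rewrite gate_id // eq_sym (dicycle_neq cact dL luL); split=> //; apply: unL;
  rewrite // eq_sym (dicycle_neq cact dL luL).
Qed.

Lemma leaf_pred L l u : leaf L l -> (u, l) \in L -> ~~ shared e u /\ gate e L u != l.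
Proof.
case=> dL lL unL ulL; have uL := cyc_verts_tail ulL.
by rewrite gate_id // (dicycle_neq cact dL ulL); split=> //; apply: unL;
  rewrite // (dicycle_neq cact dL ulL).
Qed.

Lemma apart_neq C c D d z z' : apart e C c D d -> gate e C z != c ->
  gate e D z' != d -> z != z'.
Proof. by move=> ap /ap zd; apply: contra => /eqP <-; apply/eqP. Qed.

Lemma succ_neq_pred L l u w : dicycle e L -> (l, u) \in L -> (w, l) \in L -> u != w.
Proof.
move=> dL luL; apply: contraTneq => <-; exact: (dicycle_asym cact dL).
Qed.

Lemma never_both_heads C c v D d w : dicycle e C -> dicycle e D ->
  (c, v) \in C -> (d, w) \in D -> ~~ shared e v -> ~~ shared e w -> apart e C c D d ->
  never_both e v w.
Proof.
move=> dC dD cv dw nv nw ap x y p dp /internal_sub[vp _] /internal_sub[wp _].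
exact: (apart_no_heads cact dC dD cv dw nv nw ap dp).
Qed.

Lemma never_both_tails C c v D d w : dicycle e C -> dicycle e D ->
  (v, c) \in C -> (w, d) \in D -> ~~ shared e v -> ~~ shared e w -> apart e C c D d ->
  never_both e v w.
Proof.
move=> dC dD cv dw nv nw ap x y p dp /internal_sub[_ vp] /internal_sub[_ wp].
exact: (apart_no_tails cact dC dD cv dw nv nw ap dp).
Qed.

(** * Colourings obtained from two leaf cycles *)

Section TwoLeaves.
Variables (A B : {set T * T}) (a b : T).
Hypotheses (La : leaf A a) (Lb : leaf B b) (apAB : apart e A a B b).

(** The successors of [a] and [b] share one colour, their predecessors another. *)
Lemma leaves_vertex_colouring : path_vertex_colouring e (#|T| - 2).
Proof.
have [dA aA _] := La; have [dB bB _] := Lb.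
have [a1 aa1] := dicycle_succ aA; have [a2 aa2] := dicycle_pred dA aA.
have [b1 bb1] := dicycle_succ bB; have [b2 bb2] := dicycle_pred dB bB.
have [na1 ga1] := leaf_succ La aa1; have [na2 ga2] := leaf_pred La aa2.
have [nb1 gb1] := leaf_succ Lb bb1; have [nb2 gb2] := leaf_pred Lb bb2.
have apBA := apart_sym apAB; apply: (@merge2_vertex_colouring _ _ a1 a2 b1 b2).
- rewrite (succ_neq_pred dA aa1 aa2) (succ_neq_pred dB bb1 bb2).
  rewrite (apart_neq apBA gb1 ga1) (apart_neq apBA gb1 ga2).
  by rewrite (apart_neq apBA gb2 ga1) (apart_neq apBA gb2 ga2).
- exact: (never_both_heads dA dB aa1 bb1).
- exact: (never_both_tails dA dB aa2 bb2).
Qed.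

Lemma leaves_arc_colouring : path_arc_colouring e (#|T| - 1).
Proof.
have [dA aA _] := La; have [dB bB _] := Lb.
have [a1 aa1] := dicycle_succ aA; have [b1 bb1] := dicycle_succ bB.
have [na1 ga1] := leaf_succ La aa1; have [nb1 gb1] := leaf_succ Lb bb1.
have ab1 := apart_neq apAB ga1 gb1.
(* Only the successors are merged: the argument for predecessors does not cover the last vertex of a
   path, which is still the head of an arc. *)
pose g x := if x == a1 then b1 else x.
have gU x : g x \notin [set a1].
  by rewrite /g inE; case: (eqVneq x a1) => //; rewrite eq_sym.
have T0 : 0 < #|T| by apply/card_gt0P; exists a.
have [c cP] := merge_colours T0 gU; rewrite cards1 in c cP.
exists (fun f : T * T => c f.2) => x y p dp.
rewrite (map_comp c snd) map_path_arcs_head map_inj_in_uniq; last first.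
  have nab : a1 \in p -> b1 \in p -> False.
    exact: (apart_no_heads cact dA dB aa1 bb1 na1 nb1 apAB dp).
  move=> v w vp wp /cP; rewrite /g.
  case: (eqVneq v a1) => [va|_]; case: (eqVneq w a1) => [wa|_] // E.
  - by rewrite va wa.
  - by case: nab; [rewrite -va|rewrite E].
  - by case: nab; [rewrite -wa|rewrite -E].
by case: dp => _ _ /andP[].
Qed.

(** The three successors [a1], [b1], [l1] share one colour and the predecessors [a2], [b2] another,
    which saves three colours. *)
Lemma third_leaf_vertex_colouring L l : leaf L l -> apart e A a L l -> apart e B b L l ->
  path_vertex_colouring e (#|T| - 3).
Proof.
move=> Ll apAL apBL.
have [dA aA _] := La; have [dB bB _] := Lb; have [dL lL _] := Ll.
have [a1 aa1] := dicycle_succ aA; have [a2 aa2] := dicycle_pred dA aA.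
have [b1 bb1] := dicycle_succ bB; have [b2 bb2] := dicycle_pred dB bB.
have [l1 ll1] := dicycle_succ lL.
have [na1 ga1] := leaf_succ La aa1; have [na2 ga2] := leaf_pred La aa2.
have [nb1 gb1] := leaf_succ Lb bb1; have [nb2 gb2] := leaf_pred Lb bb2.
have [nl1 gl1] := leaf_succ Ll ll1.
have a12 := succ_neq_pred dA aa1 aa2; have b12 := succ_neq_pred dB bb1 bb2.
apply: (@merge3_vertex_colouring _ _ b1 l1 b2 a1 a1 a2).
- by rewrite (apart_neq apBL gb1 gl1) b12 eq_sym (apart_neq apBL gb2 gl1).
- by rewrite (apart_neq apAB ga1 gb1) (apart_neq apAL ga1 gl1) (apart_neq apAB ga1 gb2).
- by rewrite (apart_neq apAB ga1 gb1) (apart_neq apAL ga1 gl1) (apart_neq apAB ga1 gb2).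
- by rewrite (apart_neq apAB ga2 gb1) (apart_neq apAL ga2 gl1) (apart_neq apAB ga2 gb2).
- by [].
- by [].
- exact/never_both_sym/(never_both_heads dA dB aa1 bb1).
- exact/never_both_sym/(never_both_heads dA dL aa1 ll1).
- exact/never_both_sym/(never_both_tails dA dB aa2 bb2).
- by move=> _; apply: (never_both_heads dB dL bb1 ll1).
Qed.

(** Seen from [C], the leaf [A] sits at the gate of [x] and [B] at the gate [c] of [y]. If these
    gates coincide, or if the successor [p] of [c] is shared, a third leaf lies elsewhere; otherwise
    [p] is unshared and is the further vertex. *)
Lemma bad_cycle x y C : (a, x) \in A -> (y, b) \in B -> dicycle e C ->
    (gate e C y, gate e C x) \notin C ->
  (exists L l, [/\ leaf L l, apart e A a L l & apart e B b L l]) \/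
  (exists D c v, [/\ dicycle e D, D != A, D != B & [/\ (c, v) \in D, ~~ shared e v,
    apart e B b D c & forall z, gate e A z != a -> gate e D z != c]]).
Proof.
move=> axA ybB dC badC; have [dA aA _] := La; have [dB bB _] := Lb.
have [nx gx] := leaf_succ La axA; have [ny gy] := leaf_pred Lb ybB.
(* By the choice of [x] and [y], the arcs [(a, x)] and [(y, b)] join the gates in [A] and in [B], so
   the obstruction is neither of the two. *)
have CA : C != A.
  apply: contraNneq badC => ->; rewrite (apart_sym apAB gy).
  by rewrite (gate_id cact dA (cyc_verts_head dA axA)).
have CB : C != B.
  apply: contraNneq badC => ->; rewrite (apAB gx).
  by rewrite (gate_id cact dB (cyc_verts_tail ybB)).
have gA z : gate e A z != a -> gate e C z = gate e C x.
  by move=> /(leaf_gate La) zA; apply: (gate_cycle cact dC dA) => //; exact (cyc_verts_head dA axA).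
have gB z : gate e B z != b -> gate e C z = gate e C y.
  by move=> /(leaf_gate Lb) zB; apply: (gate_cycle cact dC dB) => //; exact (cyc_verts_tail ybB).
(* A part beyond [w] that avoids the gates of both leaves contains a leaf apart from both. *)
have third D w : dicycle e D -> w \in cyc_verts D ->
    (forall z, gate e D z != w -> gate e C z != gate e C x /\ gate e C z != gate e C y) ->
    exists L l, [/\ leaf L l, apart e A a L l & apart e B b L l].
  move=> dD wD out; have [L [l [Ll subL]]] := leaf_exists dD wD.
  exists L, l; split=> // z; [move/gA => E|move/gB => E]; apply/eqP/negPn/negP => /subL /out.
    by rewrite E eqxx => -[].
  by rewrite E eqxx => -[].
set c := gate e C y in badC gB third; have cC : c \in cyc_verts C by apply: gate_in.
have [p cpC] := dicycle_succ cC; have pC := cyc_verts_head dC cpC.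
have px : p != gate e C x by apply: contraNneq badC => <-.
have [/(other_cycle C)[E [dE EC pE]]|np] := boolP (shared e p).
  left; apply: (third E p) => // z zp.
  have -> : gate e C z = p by apply: (gate_opposite cact dE dC).
  by rewrite px eq_sym (dicycle_neq cact dC cpC).
have [xc|xc] := eqVneq (gate e C x) c.
  by left; apply: (third C c) => // z zc; rewrite xc.
right; exists C, c, p; split=> //; split=> // z; by move/gA=> ->.
Qed.

End TwoLeaves.

(** * Spanning pairs and the resulting bounds *)

Definition spanning_pair x y := [forall C, dicycleb e C ==> ((gate e C y, gate e C x) \in C)].

Lemma spanning_pairP x y :
  reflect (forall C, dicycle e C -> (gate e C y, gate e C x) \in C) (spanning_pair x y).
Proof.
apply: (iffP forallP) => H C; first by move/dicycleP; apply/implyP.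
by apply/implyP => /dicycleP /H.
Qed.

(** The pairs [(a1, b2)] and [(b1, a2)] are both obstructed. Unless a third leaf appears, the
    obstructions supply [p] and [r]: then [a1] is merged with [r], [b1] with [p], and [a2] with
    [b2]. *)
Lemma nonspanning_vertex_colouring C D : dicycle e C -> dicycle e D -> C != D ->
  (forall x y, ~~ spanning_pair x y) -> path_vertex_colouring e (#|T| - 3).
Proof.
move=> dC dD CD bad; have [A [a [B [b [La Lb apAB]]]]] := two_leaves dC dD CD.
have [dA aA _] := La; have [dB bB _] := Lb; have apBA := apart_sym apAB.
have [a1 aa1] := dicycle_succ aA; have [a2 aa2] := dicycle_pred dA aA.
have [b1 bb1] := dicycle_succ bB; have [b2 bb2] := dicycle_pred dB bB.
have [na1 ga1] := leaf_succ La aa1; have [na2 ga2] := leaf_pred La aa2.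
have [nb1 gb1] := leaf_succ Lb bb1; have [nb2 gb2] := leaf_pred Lb bb2.
have /forallPn[E] := bad a1 b2; rewrite negb_imply => /andP[/dicycleP dE badE].
have /forallPn[F] := bad b1 a2; rewrite negb_imply => /andP[/dicycleP dF badF].
have [[L [l [Ll apA apB]]]|] := bad_cycle La Lb apAB aa1 bb2 dE badE.
  exact: (third_leaf_vertex_colouring La Lb apAB Ll apA apB).
case=> {dE badE}E [c [p [dE EA EB [cpE np apBE subA]]]].
have [[L [l [Ll apB apA]]]|] := bad_cycle Lb La apBA bb1 aa2 dF badF.
  exact: (third_leaf_vertex_colouring La Lb apAB Ll apA apB).
case=> {dF badF}F [d [r [dF FB FA [drF nr apAF subB]]]].
have in_leaf X u : dicycle e X -> X != A -> X != B -> u \in cyc_verts X -> ~~ shared e u ->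
    [&& u != a1, u != a2, u != b1 & u != b2].
  move=> dX XA XB uX nu; apply/and4P; split; [apply: contraNneq XA|apply: contraNneq XA|
    apply: contraNneq XB|apply: contraNneq XB] => E1; rewrite E1 in nu uX; apply/eqP.
  - exact: (unshared_eq nu dX dA uX (cyc_verts_head dA aa1)).
  - exact: (unshared_eq nu dX dA uX (cyc_verts_tail aa2)).
  - exact: (unshared_eq nu dX dB uX (cyc_verts_head dB bb1)).
  - exact: (unshared_eq nu dX dB uX (cyc_verts_tail bb2)).
have pE := cyc_verts_head dE cpE; have rF := cyc_verts_head dF drF.
have /and4P[pa1 pa2 pb1 pb2] := in_leaf E p dE EA EB pE np.
have /and4P[ra1 ra2 rb1 rb2] := in_leaf F r dF FA FB rF nr.
(* If [p = r], then [E = F] and [c = d], but one obstruction gives the inner vertices of [A] the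
   gate [c] and the other forbids it. *)
have pr : p != r.
  apply/eqP => pr; rewrite -pr in drF nr rF; have EF := unshared_eq np dE dF pE rF.
  rewrite -EF in drF apAF; have cd := dicycle_pred_inj dE cpE drF.
  by have := subA _ ga1; rewrite (apAF _ ga1) cd eqxx.
have a12 := succ_neq_pred dA aa1 aa2; have b12 := succ_neq_pred dB bb1 bb2.
apply: (@merge3_vertex_colouring _ _ a1 b1 a2 r p b2).
- by rewrite a12 (apart_neq apAB ga1 gb1) (apart_neq apBA gb1 ga2).
- by rewrite ra1 ra2 rb1.
- by rewrite pa1 pa2 pb1.
- by rewrite (apart_neq apBA gb2 ga1) (apart_neq apBA gb2 ga2) eq_sym b12.
- exact: rb2.
- exact: pb2.
- exact: (never_both_heads dA dF aa1 drF).
- exact: (never_both_heads dB dE bb1 cpE).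
- exact: (never_both_tails dA dB aa2 bb2).
- by move=> rp; rewrite rp eqxx in pr.
Qed.

Lemma mem_cycle_exists C v : dicycle e C -> exists2 D, dicycle e D & v \in cyc_verts D.
Proof.
move=> dC; have [u uC] := dicycle_nonempty dC.
have [->|uv] := eqVneq v u; first by exists C.
have /connectP[[|w p] /=] := cactus_connect cact v u.
  by move=> _ E; rewrite E eqxx in uv.
case/andP=> evw _ _; have [D dD vwD] := arc_dicycle cact evw.
by exists D => //; apply: cyc_verts_tail vwD.
Qed.

Lemma spanning_path C x y p : dicycle e C -> spanning_pair x y -> directed_path e x y p ->
  size p = #|T| - 1 /\ size (internal x p) = #|T| - 2.
Proof.
move=> dC /spanning_pairP sp [pth pl up].
have full v : v \in x :: p.
  have [D dD vD] := mem_cycle_exists v dC.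
  apply: (path_covers_cycle cact dD pth) => //; rewrite pl; exact: sp.
have : size (x :: p) = #|T| by rewrite -(card_uniqP up); apply: eq_card => v; rewrite full.
by rewrite /internal size_behead size_belast /= => <-; rewrite subn1 subn2.
Qed.

Lemma size_uniq_ord k (s : seq 'I_k) : uniq s -> size s <= k.
Proof. by move/card_uniqP <-; rewrite -[leqRHS]card_ord max_card. Qed.

Lemma spanning_rvc C x y k : dicycle e C -> spanning_pair x y ->
  rainbow_vertex_connected e k -> #|T| - 2 <= k.
Proof.
move=> dC sp [c /(_ x y)[p dp /size_uniq_ord]].
by rewrite size_map; case: (spanning_path dC sp dp) => _ ->.
Qed.

Lemma spanning_trc C x y k : dicycle e C -> spanning_pair x y ->
  total_rainbow_connected e k -> (#|T| - 2) + (#|T| - 1) <= k.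
Proof.
move=> dC sp [cv [ca /(_ x y)[p dp /size_uniq_ord]]].
rewrite size_cat !size_map size_pairmap.
by case: (spanning_path dC sp dp) => -> ->.
Qed.

(** Guarantees that [n - 2], [n - 3] and [2n - 3] are not truncated. Predecessor and successor of a
    vertex differ because opposite arcs are excluded. *)
Lemma dicycle_card C : dicycle e C -> 3 <= #|T|.
Proof.
move=> dC; have [u uC] := dicycle_nonempty dC.
have [v uv] := dicycle_succ uC; have [w wu] := dicycle_pred dC uC.
have <- : #|[set u; v; w]| = 3; last exact: max_card.
rewrite setUC cardsU1 !inE negb_or (dicycle_neq cact dC wu) cards2.
by rewrite (dicycle_neq cact dC uv) eq_sym (succ_neq_pred dC uv wu).
Qed.

(** A spanning pair forces a Hamiltonian path, whose inner vertices and arcs attain the upper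
    bounds. Without one, [n - 3] vertex colours suffice, and adding [n - 1] arc colours gives fewer
    than [2n - 3] in total. *)
Lemma rvc_trc_spanning C D : dicycle e C -> dicycle e D -> C != D ->
  (is_rvc e (#|T| - 2) <-> exists x y, spanning_pair x y) /\
  (is_trc e (2 * #|T| - 3) <-> exists x y, spanning_pair x y).
Proof.
move=> dC dD CD; have T3 := dicycle_card dC.
have [A [a [B [b [La Lb apAB]]]]] := two_leaves dC dD CD.
have v2 := leaves_vertex_colouring La Lb apAB.
have a1 := leaves_arc_colouring La Lb apAB.
have E : 2 * #|T| - 3 = (#|T| - 2) + (#|T| - 1) by lia.
have v3 : ~ (exists x y, spanning_pair x y) -> path_vertex_colouring e (#|T| - 3).
  move=> none; apply: (nonspanning_vertex_colouring dC dD CD) => x y.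
  by apply/negP => sp; apply: none; exists x, y.
have decide : (exists x y, spanning_pair x y) \/ ~ (exists x y, spanning_pair x y).
  have [/existsP[x /existsP[y sp]]|/existsPn none] :=
    boolP [exists x, exists y, spanning_pair x y]; first by left; exists x, y.
  right=> -[x [y sp]]; have := none x; apply/negP/negPn.
  by apply/existsP; exists y.
split; split.
- case=> _ low; case: decide => // /v3 /(path_vertex_colouring_rvc cact) /low; lia.
- case=> x [y sp]; split; first exact: path_vertex_colouring_rvc.
  by move=> k; apply: (spanning_rvc dC sp).
- case=> _ low; case: decide => // /v3 v; have := path_colouring_trc cact v a1 => /low; lia.
- case=> x [y sp]; split; first by rewrite E; apply: path_colouring_trc.
  by move=> k /(spanning_trc dC sp); rewrite E.
Qed.

End Bounds.

(** * Blocks and cut-vertices *)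

Section Components.
Variables (T : finType) (e : rel T).
Implicit Types (H : subdigraph T) (v x y : T).

Lemma underlying_connect_sym H : connect_sym (underlying H).
Proof. by apply: sym_connect_sym => x y; apply: orbC. Qed.

Lemma subdigraph_closed H : is_subdigraph e H -> closed (underlying H) H.1.
Proof.
move=> /forall_inP sub x y /= /orP[] /sub /and3P[/= _]; by do 2!move->.
Qed.

Lemma subdigraph_del H v : is_subdigraph e H -> is_subdigraph e (del_vertex H v).
Proof.
move=> /forall_inP sub; apply/forall_inP => -[x y]; rewrite !inE /= => /and3P[xyH xv yv].
by have /and3P[/= -> -> ->] := sub _ xyH; rewrite xv yv.
Qed.

Lemma n_components_le1 H :
  {in H.1 &, forall x y, connect (underlying H) x y} -> n_components H <= 1.
Proof.
move=> conn; apply/card_le1_eqP => x y; rewrite !inE => /andP[/eqP rx xH] /andP[/eqP ry yH].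
by rewrite -rx -ry; apply/rootP; [exact: underlying_connect_sym|exact: conn].
Qed.

Lemma n_components_gt0 H x : is_subdigraph e H -> x \in H.1 -> 0 < n_components H.
Proof.
move=> sub xH; have symH := @underlying_connect_sym H; apply/card_gt0P.
exists (root (underlying H) x); rewrite !inE roots_root //=.
by rewrite -(closed_connect (subdigraph_closed sub) (connect_root _ x)).
Qed.

Lemma n_components_gt1 H x y : is_subdigraph e H -> x \in H.1 -> y \in H.1 ->
  ~~ connect (underlying H) x y -> 1 < n_components H.
Proof.
move=> sub xH yH; have symH := @underlying_connect_sym H => nxy.
have rH z : z \in H.1 -> root (underlying H) z \in H.1.
  by move=> zH; rewrite -(closed_connect (subdigraph_closed sub) (connect_root _ z)).
apply/card_gt1P; exists (root (underlying H) x), (root (underlying H) y).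
rewrite !inE !roots_root //= !rH //; split=> //.
by rewrite root_connect.
Qed.

Lemma del_vertex_out H v : is_subdigraph e H -> v \notin H.1 -> del_vertex H v = H.
Proof.
move=> /forall_inP sub vH; case: H sub vH => V A /= sub vV; rewrite /del_vertex /=; congr pair.
  by apply/setP => x; rewrite !inE; case: eqP => // ->; rewrite (negbTE vV).
apply/setP => -[x y]; rewrite !inE /=; have [xyA|//] := boolP ((x, y) \in A).
have /and3P[/= _ xV yV] := sub _ xyA.
by rewrite (contraNneq _ vV) ?(contraNneq _ vV) // => <-.
Qed.

Lemma nonseparable_del H v : nonseparable e H -> n_components (del_vertex H v) <= 1.
Proof.
case/and3P=> sub /eqP n1 /forallP /(_ v); rewrite /cut_vertex n1.
have [vH|vH] := boolP (v \in H.1); last by rewrite del_vertex_out // n1.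
by rewrite /= -leqNgt.
Qed.

End Components.

(** * The blocks are the cycles and the cut-vertices are the shared vertices *)

Section Blocks.
Variables (T : finType) (e : rel T).
Hypothesis cact : cactus e.
Implicit Types (C D : {set T * T}) (H : subdigraph T) (u v w x y z : T).

Definition cycle_block C : subdigraph T := (cyc_verts C, C).

Lemma cycle_block_subdigraph C : dicycle e C -> is_subdigraph e (cycle_block C).
Proof.
move=> dC; apply/forall_inP => -[x y] /= xyC.
by rewrite (dicycle_arc dC xyC) (cyc_verts_tail xyC) (cyc_verts_head dC xyC).
Qed.

Lemma cycle_minus_connect C v w x : dicycle e C -> (v, w) \in C -> x \in cyc_verts C ->
  x != v -> connect (underlying (del_vertex (cycle_block C) v)) w x.
Proof.
move=> dC vwC xC xv; set r := underlying _.
(* The disjunct [x == v] starts the induction round [C] at [v]; the first arc then leads to [w]. *)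
suff /orP[|//] : (x == v) || connect r w x by rewrite (negbTE xv).
apply: (dicycle_ind (P := fun u => (u == v) || connect r w u) dC _ (cyc_verts_tail vwC) xC);
  last by rewrite eqxx.
move=> a b abC; have [av|av] /= := eqVneq a v.
  by rewrite av in abC; rewrite (dicycle_succ_inj dC abC vwC) connect0 orbT.
have [//|bv /= wa] := eqVneq b v; apply: connect_trans wa (connect1 _).
by rewrite /r /underlying /= !inE /= abC av bv.
Qed.

Lemma cycle_block_nonseparable C : dicycle e C -> nonseparable e (cycle_block C).
Proof.
move=> dC; have sub := cycle_block_subdigraph dC.
have conn : n_components (cycle_block C) <= 1.
  apply: n_components_le1 => x y xC yC.
  apply: connect_sub (dicycle_connect dC xC yC) => a b /= abC.
  by apply: connect1; rewrite /underlying /= abC.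
have [u uC] := dicycle_nonempty dC; have n0 := n_components_gt0 sub (uC : u \in (cycle_block C).1).
have n1 : n_components (cycle_block C) = 1 by apply/eqP; rewrite eqn_leq conn.
apply/and3P; split=> //; first by rewrite n1.
apply/forallP => v; rewrite /cut_vertex n1 negb_and -leqNgt orbC.
have [vC|vC] := boolP (v \in (cycle_block C).1); rewrite /= ?orbT ?orbF //.
have [w vwC] := dicycle_succ vC; apply: n_components_le1 => x y.
rewrite !inE => /andP[xv xC] /andP[yv yC].
apply: connect_trans (cycle_minus_connect dC vwC yC yv).
by rewrite underlying_connect_sym cycle_minus_connect.
Qed.

(** Arcs off [C] preserve the gate, and an arc of [C] that avoids the deleted vertex joins two
    vertices whose gates both differ from it. *)
Lemma gate_del_connect C H x y : dicycle e C -> is_subdigraph e H ->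
  connect (underlying (del_vertex H (gate e C x))) x y -> gate e C y = gate e C x.
Proof.
move=> dC /forall_inP sub; set w := gate e C x.
have step a b : e a b -> a != w -> b != w -> (gate e C a == w) = (gate e C b == w).
  move=> eab aw bw; have [abC|abC] := boolP ((a, b) \in C).
    rewrite (gate_id cact dC (cyc_verts_tail abC)) (gate_id cact dC (cyc_verts_head dC abC)).
    by rewrite (negbTE aw) (negbTE bw).
  by rewrite (gate_arc cact dC eab abC).
have cl : closed (underlying (del_vertex H w)) [pred a | gate e C a == w].
  move=> a b /= /orP[]; rewrite !inE => /and3P[abH aw bw];
    have /and3P[/= eab _ _] := sub _ abH; first exact: step.
  by rewrite (step b a).
by move=> /(closed_connect cl); rewrite !inE eqxx => /esym/eqP.
Qed.

Lemma nonseparable_le_cycle H C0 : dicycle e C0 -> nonseparable e H ->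
  exists2 C, dicycle e C & sub_le H (cycle_block C).
Proof.
move=> dC0 nsH; have /and3P[sub /eqP n1 _] := nsH.
have [x xH] : exists x, x \in H.1.
  have /card_gt0P[x] : 0 < n_components H by rewrite n1.
  by rewrite inE => /andP[_]; exists x.
have [/existsP[[u v] uvH]|/existsPn noarc] := boolP [exists a, a \in H.2]; last first.
  have [C dC xC] := mem_cycle_exists cact x dC0; exists C => //.
  rewrite /sub_le; apply/andP; split; last by apply/subsetP => a aH; have := noarc a; rewrite aH.
  apply/subsetP => y yH; suff -> : y = x by [].
  apply/eqP/negPn/negP => yx.
  suff /(n_components_gt1 sub yH xH) : ~~ connect (underlying H) y x by rewrite n1.
  apply/negP => /connectP[[|z p] /=]; first by move=> _ E; rewrite E eqxx in yx.
  by rewrite /underlying /= !(negbTE (noarc _)).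
have /forall_inP subH := sub; have /and3P[/= euv uH vH] := subH _ uvH.
have [C dC uvC] := arc_dicycle cact euv; exists C => //.
have VH : {subset H.1 <= cyc_verts C}.
  move=> y yH; have gC := gate_in cact dC y; apply/negPn/negP => yC.
  set w := gate e C y in gC; have yw : y != w by apply: contraNneq yC => ->.
  (* One end of the arc [(u, v)] differs from the gate [w] of [y]; deleting [w] separates it from
     [y]. *)
  have [z zC /andP[zH zw]] : exists2 z, z \in cyc_verts C & (z \in H.1) && (z != w).
    have [uw|uw] := eqVneq u w; last by exists u; rewrite ?uH ?uw // (cyc_verts_tail uvC).
    exists v; first exact (cyc_verts_head dC uvC).
    by rewrite vH -uw eq_sym (dicycle_neq cact dC uvC).
  have := nonseparable_del w nsH; rewrite leqNgt => /negP; apply.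
  apply: (@n_components_gt1 _ e _ y z); rewrite ?inE ?yw ?zw //; first exact: subdigraph_del.
  apply/negP => /(gate_del_connect dC sub); rewrite (gate_id cact dC zC) => E.
  by rewrite E eqxx in zw.
rewrite /sub_le; apply/andP; split; first by apply/subsetP.
(* An arc of [H] off [C] with both ends on [C] would join equal gates, hence be a loop. *)
apply/subsetP => -[a b] abH; have /and3P[/= eab aH bH] := subH _ abH.
apply/negPn/negP => abC; have := gate_arc cact dC eab abC.
rewrite !(gate_id cact dC) ?VH // => ab; by rewrite ab cactus_irr in eab.
Qed.

Lemma cycle_block_inj C D : cycle_block C = cycle_block D -> C = D.
Proof. by case. Qed.

(** The cycle [C0] excludes the one-vertex digraph, whose block has no arcs. *)
Lemma blockP H C0 : dicycle e C0 ->
  reflect (exists2 C, dicycle e C & H = cycle_block C) (block e H).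
Proof.
move=> dC0; have le_eq C D : dicycle e C -> dicycle e D ->
    sub_le (cycle_block C) (cycle_block D) -> C = D.
  move=> dC dD /andP[_ /subsetP CD]; have [u uC] := dicycle_nonempty dC.
  have [v uvC] := dicycle_succ uC; exact: (dicycle_uniq cact dC dD uvC (CD _ uvC)).
apply: (iffP andP) => [[nsH /forallP maxH]|[C dC ->]].
  have [C dC HC] := nonseparable_le_cycle dC0 nsH; exists C => //.
  by have := maxH (cycle_block C); rewrite cycle_block_nonseparable // HC => /eqP.
split; first exact: cycle_block_nonseparable.
apply/forallP => H'; apply/implyP => /andP[nsH' CH'].
have [D dD H'D] := nonseparable_le_cycle dC0 nsH'.
have CD : C = D.
  apply: le_eq => //; case/andP: CH' H'D => V1 A1 /andP[V2 A2].
  by rewrite /sub_le (subset_trans V1 V2) (subset_trans A1 A2).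
case: H' CH' H'D {nsH'} => V' A' /andP[/= V1 A1] /andP[/= V2 A2].
rewrite -CD in V2 A2; apply/eqP; congr pair; apply/eqP; rewrite eqEsubset.
  by rewrite V2.
by rewrite A2.
Qed.

Lemma cut_vertexE C0 v : dicycle e C0 -> cut_vertex (whole e) v = shared e v.
Proof.
move=> dC0.
have subw : is_subdigraph e (whole e).
  by apply/forall_inP => -[x y]; rewrite !inE => /= ->.
have n1 : n_components (whole e) = 1.
  apply/eqP; rewrite eqn_leq (n_components_gt0 subw (x := v)) ?inE // andbT.
  apply: n_components_le1 => x y _ _; apply: connect_sub (cactus_connect cact x y) => a b eab.
  by apply: connect1; rewrite /underlying /= !inE /= eab.
rewrite /cut_vertex n1 inE /=; apply/idP/idP; last first.
  case/sharedP => C [D [dC dD CD vC vD]].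
  have [a vaC] := dicycle_succ vC; have [b vbD] := dicycle_succ vD.
  (* [b] has [C]-gate [v] while [a] is its own gate, so deleting [v] separates them. *)
  have gb : gate e C b = v.
    rewrite -[RHS](gate_id cact dC vC); apply: (gate_cycle cact dC dD) => //.
    exact (cyc_verts_head dD vbD).
  apply: (@n_components_gt1 _ e _ b a); first exact: subdigraph_del.
  - by rewrite !inE andbT eq_sym (dicycle_neq cact dD vbD).
  - by rewrite !inE andbT eq_sym (dicycle_neq cact dC vaC).
  - apply/negP; rewrite -{1}gb => /(gate_del_connect dC subw).
    rewrite gb (gate_id cact dC (cyc_verts_head dC vaC)) => E.
    by have := dicycle_neq cact dC vaC; rewrite E eqxx.
apply: contraTT => nv; rewrite -leqNgt.
have [C dC vC] := mem_cycle_exists cact v dC0; have [w wvC] := dicycle_pred dC vC.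
(* A path from [x] to [v] must end with the arc [(w, v)]; the part before it joins [x] to [w] and
   avoids [v]. *)
have tow x : x != v -> connect (underlying (del_vertex (whole e) v)) x w.
  move=> xv; have /connectP[p0 pth0] := cactus_connect cact x v.
  case/shortenP: pth0 => p pth up _ {p0}; case/lastP: p pth up => [|p v'].
    by move=> _ _ E; rewrite E eqxx in xv.
  rewrite last_rcons rcons_path -rcons_cons rcons_uniq => /andP[pth elv] /andP[vp _] E.
  rewrite -{v'}E in elv vp; have [D dD lvD] := arc_dicycle cact elv.
  have E := unshared_eq nv dC dD vC (cyc_verts_head dD lvD).
  rewrite -E in lvD; rewrite (dicycle_pred_inj dC wvC lvD).
  elim: p x {xv elv lvD} pth vp => //= y p IH x /andP[exy pth].
  rewrite inE negb_or => /andP[vx vyp]; apply: connect_trans (IH y pth vyp).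
  apply: connect1; rewrite /underlying /= !inE /= exy eq_sym vx eq_sym.
  by move: vyp; rewrite inE negb_or => /andP[->].
apply: n_components_le1 => x y; rewrite !inE !andbT => xv yv.
by apply: connect_trans (tow x xv) _; rewrite underlying_connect_sym tow.
Qed.

End Blocks.

(** * Transversal walks *)

Lemma isomorphic_sym (T1 T2 : finType) (e1 : rel T1) (e2 : rel T2) :
  isomorphic e1 e2 -> isomorphic e2 e1.
Proof.
case=> f [g fK gK] fE; exists g; first by exists f.
by move=> x y; rewrite -fE !gK.
Qed.

Section Transversal.
Variables (T : finType) (e : rel T).
Hypothesis cact : cactus e.
Implicit Types (C D : {set T * T}) (u v w x y : T) (p : seq T) (z : nat -> T).

(** The unique cycle through an arc; pairs that are not arcs get the default [set0]. *)
Definition arc_cycle (a : T * T) : {set T * T} :=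
  odflt set0 [pick C | dicycleb e C & a \in C].

Lemma arc_cycleP u v : e u v ->
  dicycle e (arc_cycle (u, v)) /\ (u, v) \in arc_cycle (u, v).
Proof.
move=> euv; rewrite /arc_cycle; case: pickP => [C /andP[/dicycleP]|none] //.
have [C /dicycleP dC uvC] := arc_dicycle cact euv.
by have := none C; rewrite dC uvC.
Qed.

Lemma arc_cycle_eq C u v : dicycle e C -> (u, v) \in C -> arc_cycle (u, v) = C.
Proof.
move=> dC uvC; have [dD uvD] := arc_cycleP (dicycle_arc dC uvC).
exact: (dicycle_uniq cact dD dC uvD).
Qed.

Definition transversal z m := [/\ forall i, i < m -> e (z i) (z i.+1),
  forall i j, i < m -> j < m ->
    arc_cycle (z i, z i.+1) = arc_cycle (z j, z j.+1) -> i = j &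
  forall C, dicycle e C -> exists2 i, i < m & (z i, z i.+1) \in C].

Lemma walk_connect_off C z i j : i <= j ->
  (forall k, i <= k < j -> e (z k) (z k.+1) /\ (z k, z k.+1) \notin C) ->
  connect (off e C) (z i) (z j).
Proof.
move=> ij; rewrite -(subnKC ij); elim: (j - i) => [|d IH] H; first by rewrite addn0.
rewrite addnS; apply: connect_trans (IH _) (connect1 _).
  by move=> k kd; apply: H; lia.
have [|ek nk] := H (i + d); first lia.
by rewrite /off /= ek.
Qed.

(** Before and after its only arc on [C] the walk stays off [C], so the ends of that arc are the
    gates of [z 0] and [z m]. *)
Lemma transversal_spanning z m : transversal z m -> spanning_pair e (z m) (z 0).
Proof.
case=> arcs inj all; apply/spanning_pairP => C dC; have [i im iC] := all C dC.
have nC k : k < m -> k != i -> (z k, z k.+1) \notin C.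
  move=> km /eqP ki; apply/negP => kC; apply: ki; apply: inj => //.
  by rewrite (arc_cycle_eq dC kC) (arc_cycle_eq dC iC).
have -> : gate e C (z 0) = z i.
  apply: (gate_eq cact dC (cyc_verts_tail iC)); apply: walk_connect_off => // k ki.
  by split; [apply: arcs|apply: nC]; lia.
have -> : gate e C (z m) = z i.+1; last by [].
apply: (gate_eq cact dC (cyc_verts_head dC iC)); rewrite (off_connect_sym cact dC).
by apply: walk_connect_off => // k ki; split; [apply: arcs|apply: nC]; lia.
Qed.

Lemma count_arcs_stay C w p t : dicycle e C -> path e w p -> t \notin p ->
  gate e C w = t -> gate e C (last w p) = t -> count (mem C) (path_arcs w p) = 0.
Proof.
move=> dC; elim: p w => //= v p IH w /andP[ewv pth]; rewrite inE negb_or => /andP[tv tp] wt lt.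
have [wvC|wvC] /= := boolP ((w, v) \in C); last first.
  by apply: IH => //; rewrite -(gate_arc cact dC ewv wvC).
have := gate_stay cact dC (c := t) pth; rewrite lt eqxx inE negb_or tv tp => /(_ isT).
by rewrite (gate_id cact dC (cyc_verts_head dC wvC)) eq_sym => /(_ tv).
Qed.

(** The first arc of [C] on the path starts at the gate of [y], hence ends at the final gate; a
    second one would require a return to that vertex. *)
Lemma count_arcs_spanning C y p : dicycle e C -> path e y p -> uniq (y :: p) ->
  (gate e C y, gate e C (last y p)) \in C -> count (mem C) (path_arcs y p) = 1.
Proof.
move=> dC; elim: p y => [|v p IH] y /=.
  by move=> _ _ yyC; have := dicycle_neq cact dC yyC; rewrite eqxx.
case/andP=> eyv pth /andP[_ up] stC; have [yvC|yvC] /= := boolP ((y, v) \in C); last first.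
  by apply: IH => //; rewrite -(gate_arc cact dC eyv yvC).
rewrite (gate_id cact dC (cyc_verts_tail yvC)) in stC.
have vl := dicycle_succ_inj dC yvC stC.
rewrite (count_arcs_stay (t := v) dC pth) //; first by case/andP: up.
by rewrite (gate_id cact dC (cyc_verts_head dC yvC)).
Qed.

Lemma path_arcs_arc y p a : path e y p -> a \in path_arcs y p -> e a.1 a.2.
Proof.
elim: p y => //= v p IH y /andP[eyv pth]; rewrite inE => /predU1P[->//|].
exact: IH.
Qed.

Lemma spanning_transversal x y : spanning_pair e x y -> exists z m, transversal z m.
Proof.
move/spanning_pairP=> sp; have [p [pth pl up]] := directed_path_exists cact y x.
exists (nth y (y :: p)), (size p).
have cnt C : dicycle e C -> count (mem C) (path_arcs y p) = 1.
  by move=> dC; apply: count_arcs_spanning => //; rewrite pl; apply: sp.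
have nthE i : i < size p -> nth (y, y) (path_arcs y p) i = (nth y (y :: p) i, nth y p i).
  by move=> ip; rewrite (nth_pairmap y).
(* A cycle occurs in this list as often as the path uses its arcs, which is once. *)
have ucs : uniq [seq arc_cycle a | a <- path_arcs y p].
  apply: count_mem_uniq => C.
  have [/mapP[[u v] uvp CE]|/count_memPn//] := boolP (C \in _).
  have [dC uvC] := arc_cycleP (path_arcs_arc pth uvp); rewrite -CE in dC uvC.
  rewrite count_map -[RHS]/1 -(cnt C dC); apply: eq_in_count => -[u' v'] /= arcp.
  have [dD uvD] := arc_cycleP (path_arcs_arc pth arcp).
  apply/eqP/idP => [<-//|]; exact: arc_cycle_eq.
split=> [i ip|i j ip jp|C dC].
- by have /pathP := pth; apply.
- move=> E; apply/eqP; rewrite -(nth_uniq set0 _ _ ucs) ?size_map ?size_pairmap //.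
  by rewrite !(nth_map (y, y)) ?size_pairmap // !nthE // E.
- have /hasP[[u v] uvp uvC] : has (mem C) (path_arcs y p) by rewrite has_count cnt.
  have ip : index (u, v) (path_arcs y p) < size p.
    by rewrite -[ltnRHS](size_pairmap pair y p) index_mem.
  by exists (index (u, v) (path_arcs y p)) => //=; rewrite -nthE // nth_index.
Qed.

(** * Structure of a cactus with a transversal walk *)

Section PathStructure.
Variables (z : nat -> T) (m : nat).
Hypothesis tz : transversal z m.

Let Cz i := arc_cycle (z i, z i.+1).

Lemma transversal_cycle i : i < m -> dicycle e (Cz i) /\ (z i, z i.+1) \in Cz i.
Proof. by case: tz => arcs _ _ /arcs/arc_cycleP. Qed.

Lemma transversal_connect i j k : i < m -> j <= k <= m -> (i < j) || (k <= i) ->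
  connect (off e (Cz i)) (z j) (z k).
Proof.
move=> im jk ijk; case: tz => arcs inj _; apply: walk_connect_off => [|l jl]; first lia.
have lm : l < m by lia.
split; first exact: arcs.
have [di _] := transversal_cycle im; apply/negP => /(arc_cycle_eq di) /(inj _ _ lm im); lia.
Qed.

(** A repetition would join both ends of the arc from [z i] off its own cycle. *)
Lemma transversal_inj i j : i <= m -> j <= m -> z i = z j -> i = j.
Proof.
wlog ij : i j / i < j => [H im jm E|im jm E].
  have [/H|/H|] := ltngtP i j; [by apply|by move=> H'; apply/esym/H'|by []].
have im' : i < m by lia.
have [dC iC] := transversal_cycle im'.
have con := transversal_connect (j := i.+1) (k := j) im' ltac:(lia) ltac:(lia).
have := dicycle_neq cact dC iC; rewrite eq_sym.
by rewrite (off_connect_eq cact dC (cyc_verts_head dC iC) (cyc_verts_tail iC)) ?eqxx // E.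
Qed.

(** The cycle [Cz j] and the walk between the two arcs join [v] to [z i.+1] off [Cz i], so these
    agree; symmetrically [v = z j]. *)
Lemma transversal_share i j v : i < j < m ->
  v \in cyc_verts (Cz i) -> v \in cyc_verts (Cz j) -> j = i.+1 /\ v = z j.
Proof.
move=> /andP[ij jm] vi vj; have im : i < m by lia.
have [dC iC] := transversal_cycle im; have [dD jD] := transversal_cycle jm.
have CD : Cz i != Cz j.
  by apply/eqP; case: tz => _ inj _ /(inj _ _ im jm); lia.
have v1 : v = z i.+1.
  apply: (off_connect_eq cact dC vi (cyc_verts_head dC iC)).
  apply: connect_trans (connect_off cact dC dD CD vj (cyc_verts_tail jD)) _.
  by rewrite (off_connect_sym cact dC); apply: transversal_connect; lia.
have v2 : v = z j.
  apply: (off_connect_eq cact dD vj (cyc_verts_tail jD)).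
  rewrite eq_sym in CD.
  apply: connect_trans (connect_off cact dD dC CD vi (cyc_verts_head dC iC)) _.
  by apply: transversal_connect; lia.
by split=> //; apply: transversal_inj; [lia|lia|rewrite -v1 -v2].
Qed.

Lemma transversal_complete C : dicycle e C -> exists2 i, i < m & C = Cz i.
Proof.
move=> dC; case: tz => _ _ /(_ C dC) [i im iC]; exists i => //.
by rewrite /Cz (arc_cycle_eq dC iC).
Qed.

Lemma transversal_sharedP v : reflect (exists2 i, 0 < i < m & v = z i) (shared e v).
Proof.
apply: (iffP (sharedP e v)) => [[C [D [dC dD CD vC vD]]]|[i im ->]].
  have [i im iE] := transversal_complete dC; have [j jm jE] := transversal_complete dD.
  rewrite {}iE {}jE in CD vC vD; have [ij|ji|ij] := ltngtP i j.
  - have [|_ ->] := transversal_share _ vC vD; [by rewrite ij|exists j => //; lia].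
  - have [|_ ->] := transversal_share _ vD vC; [by rewrite ji|exists i => //; lia].
  - by rewrite ij eqxx in CD.
have im1 : i < m by lia.
have im2 : i.-1 < m by lia.
have [dC iC] := transversal_cycle im1; have [dD jD] := transversal_cycle im2.
exists (Cz i), (Cz i.-1); split=> //.
- by apply/eqP; case: tz => _ inj _ /(inj _ _ im1 im2); lia.
- exact: cyc_verts_tail iC.
- have := cyc_verts_head dD jD; by rewrite prednK //; lia.
Qed.

Lemma transversal_mem i k : i < m -> k < m -> z i \in cyc_verts (Cz k) -> i = k \/ i = k.+1.
Proof.
move=> im km ik; have [di iC] := transversal_cycle im; have iC' := cyc_verts_tail iC.
have [lt|lt|] := ltngtP i k; [| |by left].
- have [|_ E] := transversal_share _ iC' ik; first by rewrite lt.
  by left; apply: transversal_inj; [lia|lia|].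
- by have [|E _] := transversal_share _ ik iC'; [rewrite lt|right].
Qed.

(** The arc lies on some [Cz k], which among the inner vertices contains at most [z k] and [z k.+1];
    loops and the opposite arc are excluded. *)
Lemma transversal_arc i j : 0 < i < m -> 0 < j < m -> e (z i) (z j) = (i.+1 == j).
Proof.
move=> im jm; have arcs : forall i, i < m -> e (z i) (z i.+1) by case: tz.
apply/idP/eqP => [eij|<-]; last by apply: arcs; lia.
have [C dC ijC] := arc_dicycle cact eij; have [k km CE] := transversal_complete dC.
rewrite CE in ijC dC.
have [||Ei] := transversal_mem _ km (cyc_verts_tail ijC); first lia.
  move=> Ei; have [||//] := transversal_mem _ km (cyc_verts_head dC ijC); [lia| |lia].
  by move=> Ej; rewrite Ei Ej cactus_irr in eij.
have [||Ej] := transversal_mem _ km (cyc_verts_head dC ijC); first lia.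
  by move=> Ej; have /negP[] := cactus_asym cact eij; rewrite Ei Ej; apply: arcs.
by rewrite Ei Ej cactus_irr in eij.
Qed.

Lemma transversal_block i : i < m -> block e (cycle_block (Cz i)).
Proof. by move=> /transversal_cycle[dC _]; apply/(blockP cact _ dC); exists (Cz i). Qed.

Lemma transversal_card_blocks C0 : dicycle e C0 -> #|[set H | block e H]| = m.
Proof.
move=> dC0; have -> : [set H | block e H] = [set cycle_block (Cz i) | i : 'I_m].
  apply/setP => H; rewrite inE; apply/(blockP cact H dC0)/imsetP => [[C dC ->]|[i _ ->]].
    by have [i im ->] := transversal_complete dC; exists (Ordinal im).
  by exists (Cz i) => //; case: (transversal_cycle (ltn_ord i)).
rewrite card_imset ?card_ord // => i j /cycle_block_inj E; apply: val_inj.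
by case: tz => _ inj _; exact: (inj _ _ (ltn_ord i) (ltn_ord j) E).
Qed.

Lemma transversal_block_graph C0 : dicycle e C0 -> isomorphic (block_graph e) (upath m).
Proof.
move=> dC0; apply: isomorphic_sym; case: tz => _ inj _.
pose f (i : 'I_m) : {H | block e H} := Sub _ (transversal_block (ltn_ord i)).
exists f.
  apply: inj_card_bij => [i j /(congr1 val)/cycle_block_inj E|].
    exact/val_inj/(inj _ _ (ltn_ord i) (ltn_ord j) E).
  by rewrite card_sig card_ord -(transversal_card_blocks dC0) cardsE.
move=> i j; have neq k l : k < l < m -> Cz k != Cz l.
  by move=> kl; apply/eqP => /(inj k l ltac:(lia) ltac:(lia)); lia.
have meet (k l : 'I_m) : k < l ->
    ((cyc_verts (Cz k) :&: cyc_verts (Cz l) != set0) = (k.+1 == l)).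
  move=> kl; have klm : k < l < m by rewrite kl ltn_ord.
  apply/set0Pn/eqP => [[v]|E].
    by rewrite inE => /andP[vk vl]; have [->] := transversal_share klm vk vl.
  exists (z l); rewrite inE; have [_ lC] := transversal_cycle (ltn_ord l).
  have [dk kC] := transversal_cycle (ltn_ord k).
  by rewrite (cyc_verts_tail lC) andbT -E (cyc_verts_head dk kC).
rewrite /block_graph /upath -val_eqE /=; have [ij|ji|/val_inj->] := ltngtP i j.
- rewrite meet // (_ : j.+1 == i = false) ?orbF; last by apply/eqP; lia.
  suff -> : cycle_block (Cz i) != cycle_block (Cz j) by [].
  by apply: contra (neq i j _) => [/eqP/cycle_block_inj/eqP//|]; rewrite ij ltn_ord.
- rewrite setIC meet // (_ : i.+1 == j = false) /=; last by apply/eqP; lia.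
  suff -> : cycle_block (Cz i) != cycle_block (Cz j) by [].
  rewrite eq_sym; by apply: contra (neq j i _) => [/eqP/cycle_block_inj/eqP//|]; rewrite ji ltn_ord.
- by rewrite eqxx orbb; apply/esym/negbTE/eqP; lia.
Qed.

Lemma transversal_cut_vertices C0 : dicycle e C0 ->
  isomorphic (induced e (cut_vertices e)) (dipath (m - 1)).
Proof.
move=> dC0; apply: isomorphic_sym.
(* The cut-vertices are the inner vertices [z 1] to [z (m - 1)], hence the shift of indices by
   one. *)
have bnd (i : 'I_(m - 1)) : 0 < i.+1 < m by have := ltn_ord i; lia.
have zK (i : 'I_(m - 1)) : z i.+1 \in cut_vertices e.
  rewrite inE (cut_vertexE cact _ dC0); apply/transversal_sharedP.
  by exists i.+1.
pose f i : {x | x \in cut_vertices e} := exist (fun x => x \in cut_vertices e) _ (zK i).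
exists f; last by move=> i j; rewrite /induced /= transversal_arc.
apply: inj_card_bij => [i j /(congr1 val) /= E|].
  by apply/val_inj/succn_inj/(transversal_inj _ _ E); [have := bnd i|have := bnd j]; lia.
rewrite card_sig.
apply: (leq_trans _ (leq_image_card (fun i : 'I_(m - 1) => z i.+1) predT)).
apply/subset_leq_card/subsetP => v; rewrite inE (cut_vertexE cact _ dC0).
move=> /transversal_sharedP[i im ->]; have im' : i.-1 < m - 1 by lia.
apply/imageP; exists (Ordinal im') => //.
by rewrite /= prednK //; lia.
Qed.

End PathStructure.

(** * From the path structure back to a transversal walk *)

Section Converse.
(** [pos] stands for the position of a block along the path and [h 0] to [h m] for the directed path
    of cut-vertices; in the application there are [m + 2] blocks. *)
Variables (pos : {set T * T} -> nat) (h : nat -> T) (m : nat).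
Hypothesis pos_inj : forall C D, dicycle e C -> dicycle e D -> pos C = pos D -> C = D.
Hypothesis pos_share : forall C D v, dicycle e C -> dicycle e D -> C != D ->
  v \in cyc_verts C -> v \in cyc_verts D -> pos C = (pos D).+1 \/ pos D = (pos C).+1.
Hypothesis h_shared : forall i, i <= m -> shared e (h i).
Hypothesis h_inj : forall i j, i <= m -> j <= m -> h i = h j -> i = j.
Hypothesis h_arc : forall i, i < m -> e (h i) (h i.+1).
Hypothesis h_all : forall v, shared e v -> exists2 i, i <= m & v = h i.

(** Three cycles through [v] would have positions pairwise differing by one, which parity
    forbids. *)
Lemma at_most_two_cycles v C D E : dicycle e C -> dicycle e D -> dicycle e E ->
  v \in cyc_verts C -> v \in cyc_verts D -> v \in cyc_verts E ->
  C != D -> E = C \/ E = D.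
Proof.
move=> dC dD dE vC vD vE CD.
have [->|EC] := eqVneq E C; first by left.
have [->|ED] := eqVneq E D; first by right.
have := pos_share dC dD CD vC vD; have := pos_share dE dC EC vE vC.
have := pos_share dE dD ED vE vD; lia.
Qed.

(** Each cut-vertex on [C] lies on a further cycle next to [C]. These cycles are distinct, since two
    cycles share at most one vertex, and only two positions are available. *)
Lemma at_most_two_shared C i j k : dicycle e C -> i < j < k -> k <= m ->
  h i \in cyc_verts C -> h j \in cyc_verts C -> h k \in cyc_verts C -> False.
Proof.
move=> dC ijk km iC jC kC.
have ngh l : l <= m -> h l \in cyc_verts C -> exists D, [/\ dicycle e D, D != C,
    h l \in cyc_verts D & pos D = (pos C).+1 \/ pos C = (pos D).+1].
  move=> lm lC; have [D [dD DC lD]] := other_cycle C (h_shared lm).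
  by exists D; split=> //; apply: pos_share DC lD lC.
have dif l l' D D' : l <= m -> l' <= m -> l != l' -> dicycle e D -> dicycle e D' -> D != C ->
    h l \in cyc_verts C -> h l' \in cyc_verts C ->
    h l \in cyc_verts D -> h l' \in cyc_verts D' -> pos D <> pos D'.
  move=> lm lm' ll dD dD' DC lC lC' lD lD' /(pos_inj dD dD') E; rewrite -E in lD'.
  case/eqP: ll; apply: h_inj => //.
  exact: (share_vertex_eq cact dD dC DC lD lC lD' lC').
have /andP[ij jk] := ijk.
have jm : j <= m by apply: leq_trans km; apply: ltnW.
have im : i <= m by apply: leq_trans jm; apply: ltnW.
have [D [dD DC iD pD]] := ngh i im iC.
have [E [dE EC jE pE]] := ngh j jm jC.
have [F [dF FC kF pF]] := ngh k km kC.
have := dif _ _ _ _ im jm _ dD dE DC iC jC iD jE.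
have := dif _ _ _ _ im km _ dD dF DC iC kC iD kF.
have := dif _ _ _ _ jm km _ dE dF EC jC kC jE kF.
move: ijk pD pE pF; clear; lia.
Qed.

Lemma transversal_exists C0 D0 : dicycle e C0 -> dicycle e D0 -> C0 != D0 ->
  exists z, transversal z m.+2.
Proof.
move=> dC0 dD0 CD0.
have [E [dE EN hE]] := other_cycle (arc_cycle (h 0, h 1)) (h_shared (leq0n m)).
have [y yhE] := dicycle_pred dE hE.
(* The path of cut-vertices is prolonged by one arc at each end, on a cycle not yet used there. For
   [m = 0] the arc preceding [h m] is [(y, h 0)]. *)
have [F [dF FN hF]] :=
  other_cycle (arc_cycle (if m == 0 then y else h m.-1, h m)) (h_shared (leqnn m)).
have [x hxF] := dicycle_succ hF.
pose z k := if k == 0 then y else if k == m.+2 then x else h k.-1.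
have zS i : i <= m -> z i.+1 = h i by move=> im; rewrite /z /= eqSS ltn_eqF.
have z0 : z 0 = y by [].
have zl : z m.+2 = x by rewrite /z /= eqxx.
pose Cz i := arc_cycle (z i, z i.+1).
have arcs i : i < m.+2 -> e (z i) (z i.+1).
  case: i => [|i] im; first by rewrite zS // z0; apply: dicycle_arc yhE.
  have [->|im'] := eqVneq i m; first by rewrite zl zS //; apply: dicycle_arc hxF.
  have ltim : i < m by rewrite ltn_neqAle im'.
  by rewrite (zS i) // (zS i.+1) //; apply: h_arc.
have CzP i : i < m.+2 -> dicycle e (Cz i) /\ (z i, z i.+1) \in Cz i.
  by move/arcs/arc_cycleP.
(* At the ends this is the choice of [E] and [F]; in between, a common cycle would contain three
   cut-vertices. *)
have consec i : i < m.+1 -> Cz i != Cz i.+1.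
  have [->|im] := eqVneq i m => [_|im'].
    rewrite /Cz zl zS // (arc_cycle_eq dF hxF) eq_sym.
    by move: FN; case: (m) zS => [|m'] zS' //=; rewrite zS'.
  have ltim : i < m by rewrite ltn_neqAle im.
  have E1 := zS i (ltnW ltim); have E2 := zS i.+1 ltim.
  case: i im im' ltim E1 E2 => [|i] im im' ltim E1 E2.
    by rewrite /Cz z0 E1 E2 (arc_cycle_eq dE yhE).
  have E0 := zS i (ltnW (ltnW ltim)).
  apply/eqP => CC; have [d1 a1] := CzP i.+1 (ltnW im').
  have [d2 a2] := CzP i.+2 im'.
  rewrite -CC E1 E2 in a2; rewrite E0 E1 in a1.
  apply: (at_most_two_shared d1 _ ltim (cyc_verts_tail a1) (cyc_verts_tail a2)).
    by rewrite !ltnSn.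
  exact (cyc_verts_head d1 a2).
exists z; split=> // [|C dC].
  move=> i j; wlog ij : i j / i < j => [H im jm E'|im jm].
    have [/H|/H|] := ltngtP i j; [by apply|by move=> H'; apply/esym/H'|by []].
  move=> CE; exfalso.
  (* Up to the next arc on the same cycle the walk is off that cycle, so it is back at [z i.+1]; as
     [h] is injective the two arcs are consecutive, against [consec]. *)
  have exj : exists k, (i < k) && (Cz i == Cz k) by exists j; rewrite ij; apply/eqP.
  case: (ex_minnP exj) => k /andP[ik /eqP CE'] mink {exj}.
  have km : k < m.+2 by apply: leq_ltn_trans jm; apply: mink; rewrite ij; apply/eqP.
  have [di ai] := CzP i im; have [_ ak] := CzP k km; rewrite -CE' in ak.
  have con : connect (off e (Cz i)) (z i.+1) (z k).
    apply: walk_connect_off => // l /andP[il lk].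
    split; first exact/arcs/(ltn_trans lk km).
    apply/negP => lC; have := mink l.
    by rewrite il [Cz l](arc_cycle_eq di lC) eqxx => /(_ isT); rewrite leqNgt lk.
  have := off_connect_eq cact di (cyc_verts_head di ai) (cyc_verts_tail ak) con.
  case: k ik CE' {mink ak con} km => // k ik CE' km.
  have im' : i <= m := leq_trans (ik : i <= k) (km : k <= m).
  rewrite (zS i im') (zS k km) => /(h_inj im' km) ikE.
  by have := consec i im'; rewrite CE' -ikE eqxx.
have other : exists2 D, dicycle e D & C != D.
  have [CE|CE] := eqVneq C C0; [exists D0 => //|exists C0 => //]; by rewrite CE.
(* [C] contains some cut-vertex [h i], and the only cycles through it are those of the arcs before
   and after it. *)
have [D dD CD] := other; have [v vC /h_all[i im vE]] := shared_vertex_exists cact dC dD CD.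
have [d1 a1] := CzP i (leqW im); have [d2 a2] := CzP i.+1 im.
have v1 := cyc_verts_head d1 a1; have v2 := cyc_verts_tail a2.
rewrite !zS // -vE in v1 v2.
have [|CE|CE] := at_most_two_cycles d1 d2 dC v1 v2 vC; first by apply: consec.
- by exists i; [exact: leqW|rewrite CE].
- by exists i.+1; rewrite ?CE.
Qed.

End Converse.

Lemma path_structure_transversal q C0 D0 : dicycle e C0 -> dicycle e D0 -> C0 != D0 ->
  2 <= q -> isomorphic (block_graph e) (upath q) ->
  isomorphic (induced e (cut_vertices e)) (dipath (q - 1)) -> exists z, transversal z q.
Proof.
move=> dC0 dD0 CD0; case: q => [|[|m]] // _ [f bf fE] /isomorphic_sym[].
rewrite subn1 /= => g bg gE.
(* The position is read off the isomorphism of the block graph; arc sets that do not form a block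
   get the default 0. *)
pose pos C := if insub (cycle_block C) : option {H | block e H} is Some B then val (f B) else 0.
have posE C : dicycle e C -> exists B : {H | block e H}, val B = cycle_block C /\ pos C = f B.
  move=> dC; have bC : block e (cycle_block C) by apply/(blockP cact _ dC); exists C.
  by exists (Sub _ bC); rewrite /pos insubT.
apply: (@transversal_exists pos (fun i => val (g (inord i))) m _ _ _ _ _ _ _ _ dC0 dD0 CD0).
- move=> C D /posE[B [BC ->]] /posE[B' [BD ->]] /val_inj/(bij_inj bf) E.
  by apply: cycle_block_inj; rewrite -BC -BD E.
- move=> C D v dC dD CD vC vD.
  have [B [BC ->]] := posE C dC; have [B' [BD ->]] := posE D dD.
  have : block_graph e B B'.
    rewrite /block_graph -val_eqE BC BD /=; apply/andP; split.
      by apply: contra CD => /eqP/cycle_block_inj/eqP.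
    by apply/set0Pn; exists v; rewrite inE vC.
  by rewrite -fE => /orP[/eqP|/eqP]; [right|left].
- by move=> i _; rewrite -(cut_vertexE cact _ dC0); have := valP (g (inord i)); rewrite inE.
- move=> i j im jm /val_inj/(bij_inj bg)/(congr1 val); rewrite /= !inordK //.
- move=> i im; have := gE (inord i) (inord i.+1); rewrite /induced /dipath => ->.
  by rewrite !inordK //; lia.
- move=> v; rewrite -(cut_vertexE cact _ dC0) => cv.
  have vK : v \in cut_vertices e by rewrite inE.
  have [g' gK g'K] := bg; exists (g' (exist (fun x => x \in cut_vertices e) v vK)).
    by rewrite -ltnS ltn_ord.
  by rewrite inord_val g'K.
Qed.

Lemma spanning_iff_path_structure q C0 D0 : dicycle e C0 -> dicycle e D0 -> C0 != D0 ->
  #|[set H | block e H]| = q -> 2 <= q ->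
  (exists x y, spanning_pair e x y) <->
  isomorphic (block_graph e) (upath q) /\
  isomorphic (induced e (cut_vertices e)) (dipath (q - 1)).
Proof.
move=> dC0 dD0 CD0 qE q2; split=> [[x [y /spanning_transversal[z [m tz]]]]|[iB iK]].
  rewrite -qE (transversal_card_blocks tz dC0).
  by split; [apply: (transversal_block_graph tz dC0)|apply: (transversal_cut_vertices tz dC0)].
have [z /transversal_spanning sp] := path_structure_transversal dC0 dD0 CD0 q2 iB iK.
by exists (z q), (z 0).
Qed.

End Transversal.

Theorem theorem28 (T : finType) (e : rel T) (n q : nat)
    (hQ : nq_cactus e n q) (hq : 2 <= q) :
  (is_rvc e (n - 2) <-> is_trc e (2 * n - 3)) /\
  (is_trc e (2 * n - 3) <->
    isomorphic (block_graph e) (upath q) /\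
    isomorphic (induced e (cut_vertices e)) (dipath (q - 1))).
Proof.
case: hQ => cact <- qE.
have [C [D [dC dD CD]]] : exists C D, [/\ dicycle e C, dicycle e D & C != D].
  have /card_gt1P[B [B' [bB bB' BB']]] : 1 < #|[set H | block e H]| by rewrite qE.
  rewrite !inE in bB bB'.
  have [/existsP[x /existsP[y exy]]|/existsPn noarc] := boolP [exists x, exists y, e x y].
    have [C0 dC0 _] := arc_dicycle cact exy.
    have /(blockP cact _ dC0)[C dC BE] := bB; have /(blockP cact _ dC0)[D dD BE'] := bB'.
    by exists C, D; split=> //; apply: contra BB' => /eqP CD; rewrite BE BE' CD.
  (* Without arcs, strong connectivity leaves at most one vertex and all blocks coincide, contrary
     to [q >= 2]. *)
  have arc0 (H : subdigraph T) : block e H -> H.2 = set0.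
    case/andP=> /and3P[/forall_inP sub _ _] _; apply/setP => -[x y]; rewrite inE.
    apply/negP => /sub /and3P[/= exy _ _]; have := noarc x.
    by apply/negP/negPn/existsP; exists y.
  have eqT (x y : T) : x = y.
    have /connectP[[|z p] //=] := cactus_connect cact x y.
    by case/andP=> exz; have /existsPn/(_ z) := noarc x; rewrite exz.
  have vert (H : subdigraph T) : block e H -> H.1 = setT.
    case/andP=> /and3P[_ /eqP n1 _] _; apply/setP => x; rewrite inE.
    have /card_gt0P[y] : 0 < n_components H by rewrite n1.
    by rewrite inE => /andP[_]; rewrite (eqT y x).
  case/eqP: BB'; move: (arc0 _ bB) (arc0 _ bB') (vert _ bB) (vert _ bB').
  by case: B B' {bB bB'} => [V A] [V' A'] /= -> -> -> ->.
have [rvcE trcE] := rvc_trc_spanning cact dC dD CD.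
have spE := spanning_iff_path_structure cact dC dD CD qE hq.
by rewrite rvcE trcE spE.
Qed.
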